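(* Let $r_1,\ldots,r_s$ be positive integers and let $G$ be a $2$-connected nonhamiltonian graph of order $n$, circumference $c$ and minimum degree $\delta(G)\ge k$. Then $$N(K_{r_1,\ldots,r_s},G)\le \max\{g_{r_1,\ldots,r_s}(n,c,k),\ g_{r_1,\ldots,r_s}(n,c,\lfloor c/2\rfloor)\}.$$
   Context: The circumference of a graph is the length of a longest cycle in it. For positive integers $r_1,\ldots,r_s$, $K_{r_1,\ldots,r_s}$ denotes the complete multipartite graph with $s$ parts of sizes $r_1,\ldots,r_s$. For graphs $H$ and $G$, $N(H,G)$ denotes the number of subgraphs of $G$ isomorphic to $H$ (copies of $H$ in $G$). For integers $n,c,k$ with $k\ge 0$ and $n-1\ge c\ge 2k$, let $G(n,c,k)=K_k\vee\left(K_{c+1-2k}+\overline{K_{n-c-1+k}}\right)$, where $\vee$ denotes the join of two graphs (disjoint union plus all edges between them), $+$ denotes disjoint union, $K_m$ is the complete graph on $m$ vertices ($K_0$ being the empty graph), and $\overline{K_m}$ is the edgeless graph on $m$ vertices. Define $g_{r_1,\ldots,r_s}(n,c,k)=N(K_{r_1,\ldots,r_s},G(n,c,k))$. *)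

(* Defs.v *)
From HB Require Import structures.
From mathcomp Require Import all_boot.

Set Implicit Arguments.
Unset Strict Implicit.
Unset Printing Implicit Defensive.

Record sgraph := SGraph {
  vertex :> finType;
  adj : rel vertex;
  adj_sym : symmetric adj;
  adj_irr : irreflexive adj
}.

Section Invariants.
Variable G : sgraph.

Definition edges : {set {set G}} :=
  [set [set x; y] | x in G, y in adj x].

Definition degree (x : G) : nat := #|[set y | adj x y]|.

(* Every degree is smaller than #|G|, so the neutral value plays no role
   unless G is empty. *)
Definition min_degree : nat := \big[minn/#|G|]_(x : G) degree x.

(* p lists the vertices of a cycle in cyclic order; its length is size p. *)
Definition is_cycle (p : seq G) : bool := (2 < size p) && ucycleb (@adj G) p.

Definition hamiltonian : Prop :=
  exists2 p : seq G, is_cycle p & forall x : G, x \in p.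

(* A cycle has at most #|G| vertices; the value is 0 on acyclic graphs. *)
Definition circumference : nat :=
  \max_(l < #|G|.+1 | [exists p : l.-tuple G, is_cycle p]) l.

(* Adjacency in the graph obtained by deleting the vertices of S. *)
Definition adj_del (S : {set G}) : rel G :=
  [rel x y | [&& x \notin S, y \notin S & adj x y]].

Definition k_connected (k : nat) : Prop :=
  k < #|G| /\
  forall S : {set G}, #|S| < k ->
    {in ~: S &, forall x y, connect (adj_del S) x y}.

End Invariants.

(* A subgraph of G is a pair (S, F) of a vertex set and an edge set. *)
Definition is_subgraph (G : sgraph) (K : {set G} * {set {set G}}) : bool :=
  (K.2 \subset edges G) && [forall e in K.2, e \subset K.1].

(* f is an isomorphism from H onto the subgraph K = (S, F). *)
Definition is_iso_onto (H G : sgraph) (K : {set G} * {set {set G}})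
    (f : {ffun H -> G}) : bool :=
  [&& injectiveb f, [set f x | x : H] == K.1 &
      [forall x, forall y, adj x y == ([set f x; f y] \in K.2)]].

Definition copies (H G : sgraph) : nat :=
  #|[set K : {set G} * {set {set G}} |
      is_subgraph K && [exists f : {ffun H -> G}, is_iso_onto K f]]|.

Section Constructions.

Definition complete_adj (n : nat) : rel 'I_n := [rel x y | x != y].
Fact complete_sym n : symmetric (@complete_adj n).
Proof. by move=> x y; rewrite /complete_adj /= eq_sym. Qed.
Fact complete_irr n : irreflexive (@complete_adj n).
Proof. by move=> x; rewrite /complete_adj /= eqxx. Qed.
Definition complete (n : nat) : sgraph :=
  SGraph (@complete_sym n) (@complete_irr n).

Definition compl_adj (G : sgraph) : rel G :=
  [rel x y | (x != y) && ~~ adj x y].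
Fact compl_sym G : symmetric (@compl_adj G).
Proof. by move=> x y; rewrite /compl_adj /= eq_sym adj_sym. Qed.
Fact compl_irr G : irreflexive (@compl_adj G).
Proof. by move=> x; rewrite /compl_adj /= eqxx. Qed.
Definition complement (G : sgraph) : sgraph :=
  SGraph (@compl_sym G) (@compl_irr G).

(* b tells whether the two sides are completely joined. *)
Definition sum_adj (b : bool) (G H : sgraph) : rel (G + H)%type :=
  fun u v => match u, v with
  | inl x, inl y => adj x y
  | inr x, inr y => adj x y
  | _, _ => b
  end.
Fact sum_sym b G H : symmetric (@sum_adj b G H).
Proof. by move=> [x|x] [y|y] //=; rewrite adj_sym. Qed.
Fact sum_irr b G H : irreflexive (@sum_adj b G H).
Proof. by move=> [x|x] /=; rewrite adj_irr. Qed.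
Definition disjoint_union (G H : sgraph) : sgraph :=
  SGraph (@sum_sym false G H) (@sum_irr false G H).
Definition join (G H : sgraph) : sgraph :=
  SGraph (@sum_sym true G H) (@sum_irr true G H).

Definition multipartite_adj (s : nat) (r : 'I_s -> nat) :
  rel {i : 'I_s & 'I_(r i)} := [rel u v | tag u != tag v].
Fact multipartite_sym s r : symmetric (@multipartite_adj s r).
Proof. by move=> u v; rewrite /multipartite_adj /= eq_sym. Qed.
Fact multipartite_irr s r : irreflexive (@multipartite_adj s r).
Proof. by move=> u; rewrite /multipartite_adj /= eqxx. Qed.
Definition complete_multipartite (s : nat) (r : 'I_s -> nat) : sgraph :=
  SGraph (@multipartite_sym s r) (@multipartite_irr s r).

End Constructions.

(* K_k v (K_(c+1-2k) + complement of K_(n-c-1+k)), meaningful when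
   2 k <= c <= n - 1, in which case no subtraction is truncated. *)
Definition extremal_graph (n c k : nat) : sgraph :=
  join (complete k)
    (disjoint_union (complete (c + 1 - 2 * k))
                    (complement (complete (n - c - 1 + k)))).

Definition extremal_copies (s : nat) (r : 'I_s -> nat) (n c k : nat) : nat :=
  copies (complete_multipartite r) (extremal_graph n c k).

(* Main.v *)
Require Import Defs.
From mathcomp Require Import all_boot zify.

Set Implicit Arguments.
Unset Strict Implicit.
Unset Printing Implicit Defensive.

(* Kopylov's method. Add edges to G until every new edge would create a cycle
   longer than c; nonadjacent vertices are then joined by paths on more than c
   vertices. In a 2-connected graph a path on at least L vertices whose ends
   have at least L neighbours on it, counted together, forces a cycle of length
   at least L. Hence the vertices surviving the successive deletion of vertices
   of degree at most c/2 form a clique, and if there are h of them, then the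
   deletion of vertices of degree at most j = c + 1 - h stops at the same clique,
   with k <= j <= c/2. Each deleted vertex lies in at most as many embeddings
   as a vertex of the independent part of G(n,c,j), so G contains at most
   g(n,c,j) copies; and g(n,c,j) is convex in j. Copies are counted as
   embeddings, since both sides differ by the same number of automorphisms. *)

(** * Long cycles from long paths *)

(** Saturation costs nothing: added edges keep 2-connectivity and the minimum degree, lose no
    embedding, and respect the bound c on cycle lengths. It buys the following: if two vertex sets
    induce minimum degrees at least a and b with a + b > c, then any two distinct vertices, one from
    each set, are adjacent. Otherwise the path between a nonadjacent pair could be lengthened until
    each end has all its neighbours within its own set on the path. With a = b = floor(c/2) + 1 this
    makes the core a clique. With the degrees j + 1 and h - 1, which must add up to more than c, it
    dictates the choice j = c + 1 - h. Complete multipartite graphs fit the deletion argument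
    because an embedding that sends h to a deleted vertex v must send every class but that of h into
    the at most j neighbours of v, while the rest of the class of h may go anywhere. For an
    independent vertex of G(n,c,j) this restriction is the only one. *)

Lemma split_first (T : Type) (P : pred T) (p : seq T) :
  has P p -> exists q1 w q2, [/\ p = q1 ++ w :: q2, P w & ~~ has P q1].
Proof.
elim: p => //= z p IHp; case: (boolP (P z)) => [Pz _|Pz /IHp [q1 [w [q2 [-> Pw q1P]]]]].
  by exists [::], z, p.
by exists (z :: q1), w, q2; rewrite /= negb_or Pz.
Qed.

Lemma split_last (T : Type) (P : pred T) (p : seq T) :
  has P p -> exists q1 w q2, [/\ p = q1 ++ w :: q2, P w & ~~ has P q2].
Proof.
rewrite -has_rev => /split_first [q1 [w [q2 [Ep Pw Pq1]]]].
exists (rev q2), w, (rev q1); split=> //; last by rewrite has_rev.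
by rewrite -[p]revK Ep rev_cat rev_cons cat_rcons.
Qed.

(** * Disjoint links and detours in a 2-connected graph *)

Section Graph.
Variables (V : finType) (e : rel V).
Hypotheses (e_sym : symmetric e) (e_irr : irreflexive e).

Definition deleted (v : V) : rel V := [rel a b | [&& a != v, b != v & e a b]].

Definition biconnected : Prop :=
  forall v x y, x != v -> y != v -> connect (deleted v) x y.

Lemma path_rev x s : path e (last x s) (rev (belast x s)) = path e x s.
Proof. by rewrite rev_path; apply: eq_path => a b; rewrite e_sym. Qed.

Lemma last_rev_belast (x z : V) s : last z (rev (belast x s)) = if s is [::] then z else x.
Proof. by case: s => //= y s; rewrite rev_cons last_rcons. Qed.

Lemma last_rev (x : V) s : last (last x s) (rev (belast x s)) = x.
Proof. by rewrite last_rev_belast; case: s. Qed.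

Lemma rev_belast (x : V) s : last x s :: rev (belast x s) = rev (x :: s).
Proof. by rewrite [in RHS]lastI rev_rcons. Qed.

Lemma closed_walk_cycle x r : path e x r -> last x r = x -> r != [::] -> cycle e r.
Proof.
case/lastP: r => // r y; rewrite last_rcons => pr Ey _.
by rewrite -rot1_cons rot_cycle /= Ey -{2}Ey.
Qed.

(** A path from [a] to [b] that avoids [v] is cut at its last vertex in [A], and what follows is cut
    at its first vertex in [B]. The sets may meet, so [s] may be empty. *)
Lemma linking_path v (A B : {set V}) a b :
  biconnected -> a \in A -> b \in B -> a != v -> b != v ->
  exists w s, [/\ path e w s, uniq (w :: s), v \notin w :: s, w \in A & last w s \in B]
    /\ (forall z, z \in s -> z \notin A)
    /\ (forall z, z \in w :: s -> z \in B -> z = last w s).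
Proof.
move=> C2 aA bB av bv.
case/connectP: (C2 v a b av bv) => s0 ps0 Eb0.
case: (shortenP ps0) Eb0 => s ps us _ Eb {s0 ps0}.
have hA : has [in A] (a :: s) by rewrite /= aA.
have [q1 [w [q2 [E1 wA q2A]]]] := split_last hA.
have hB : has [in B] (w :: q2).
  apply/hasP; exists b => //; rewrite Eb.
  have -> : last a s = last v (a :: s) by [].
  by rewrite E1 last_cat /= mem_last.
have [p1 [z [p2 [E2 zB p1B]]]] := split_first hB.
have avs : v \notin a :: s.
  elim: s a ps {us Eb hA E1 aA} av => [|c s IHs] a /=; first by rewrite inE eq_sym.
  by case/andP=> /and3P [_ cv _] ps av; rewrite inE negb_or eq_sym av IHs.
have pw : path e w q2.
  have : path (deleted v) w q2.
    case: q1 E1 => [[<- <-] //|c q1 [_ E1]].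
    by move: ps; rewrite E1 cat_path /= => /and3P [].
  by apply: sub_path => c d /and3P [].
move: us avs; rewrite E1 cat_uniq mem_cat negb_or => /and3P [_ _ uw] /andP [_ vw].
have [p [Ep pz]] : exists p, w :: q2 = w :: (p ++ p2) /\ w :: p = rcons p1 z.
  case: p1 E2 {p1B} => [[-> ->]|c p1 [-> ->]]; first by exists [::].
  by exists (rcons p1 z); rewrite cat_rcons.
exists w, p; have lp : last w p = z.
  by have -> : last w p = last w (w :: p) by []; rewrite pz last_rcons.
case: Ep => Ep; rewrite Ep in pw uw vw q2A.
split.
  split=> //; last by rewrite lp.
  - by move: pw; rewrite cat_path => /andP [].
  - by move: uw; rewrite -cat_cons cat_uniq => /andP [].
  - by move: vw; rewrite -cat_cons mem_cat negb_or => /andP [].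
split=> [c cp|c].
  apply: contra q2A => cA; apply/hasP; exists c => //.
  by rewrite mem_cat cp.
rewrite pz lp mem_rcons inE => /orP [/eqP //|cp] cB.
by case/hasP: p1B; exists c.
Qed.

(** The links are numbered by their ends. Which of them starts in [alpha] stays open, because an
    augmentation may exchange their roles. *)
Definition disjoint_links (A B : {set V}) (alpha beta a1 : V) s1 a2 s2 : Prop :=
  [/\ path e a1 s1, path e a2 s2, uniq (a1 :: s1), uniq (a2 :: s2)
    & forall z, z \in a1 :: s1 -> z \in a2 :: s2 -> False] /\
  [/\ last a1 s1 = beta, last a2 s2 \in B,
      a1 = alpha /\ a2 \in A \/ a2 = alpha /\ a1 \in A,
      forall z, z \in a1 :: s1 ++ a2 :: s2 -> z \in A -> z = a1 \/ z = a2
    & forall z, z \in a1 :: s1 ++ a2 :: s2 -> z \in B -> z = last a2 s2].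

(* Menger's theorem for two paths, in augmenting form: besides the sets A and B
   the links use both ends of the given path alpha :: u. By induction on the
   path, its last vertex being first added to B. *)
Lemma two_links (u : seq V) alpha (A B : {set V}) a b :
  biconnected -> path e alpha u -> uniq (alpha :: u) ->
  a \in A -> b \in B ->
  (forall z, z \in A -> z \in B -> False) ->
  (forall z, z \in alpha :: u -> (z \notin A) && (z \notin B)) ->
  exists a1 s1 a2 s2,
    disjoint_links A B alpha (last alpha u) a1 s1 a2 s2.
Proof.
move=> C2; elim/last_ind: u B b => [|u beta IHu] B b pu uu aA bB AB uAB.
  have /andP [alA alB] := uAB _ (mem_head _ _).
  have aal : a != alpha by apply: contraNneq alA => <-.
  have bal : b != alpha by apply: contraNneq alB => <-.
  have [w [s [[pw uw alw wA lB] [sA sB]]]] := linking_path C2 aA bB aal bal.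
  exists alpha, [::], w, s; split; split=> //.
  - by move=> z; rewrite inE => /eqP ->; rewrite (negPf alw).
  - by left.
  - move=> z /=; rewrite !inE => /or3P [/eqP->|/eqP->|/sA/negPf->] //; first by left.
    by right.
  - move=> z /=; rewrite inE => /orP [/eqP->|]; first by rewrite (negPf alB).
    exact: sB.
rewrite last_rcons; move: pu uu; rewrite rcons_path -rcons_cons rcons_uniq.
move=> /andP [pu eb] /andP [bu uu].
have /andP [beA beB] : (beta \notin A) && (beta \notin B).
  by apply: uAB; rewrite -rcons_cons mem_rcons mem_head.
have [|||a1 [s1 [a2 [s2 [[p1 p2 u1 u2 d12] [l1 l2 h12 hA hB]]]]]] :=
  IHu (beta |: B) beta pu uu aA.
- by rewrite !inE eqxx.
- move=> z zA; rewrite !inE => /orP [/eqP Ez|]; last exact: AB.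
  by rewrite Ez (negPf beA) in zA.
- move=> z zu; have /andP [-> zB] : (z \notin A) && (z \notin B).
    by apply: uAB; rewrite -rcons_cons mem_rcons inE zu orbT.
  by rewrite !inE negb_or zB andbT; apply: contraNneq bu => <-.
have {}hA z : (z \in a1 :: s1) || (z \in a2 :: s2) -> z \in A -> z = a1 \/ z = a2.
  by rewrite -mem_cat; apply: hA.
have {}hB z : (z \in a1 :: s1) || (z \in a2 :: s2) -> (z == beta) || (z \in B) -> z = last a2 s2.
  by rewrite -mem_cat => zz zB; apply: hB zz _; rewrite !inE.
have l1X := mem_last a1 s1; have l2Y := mem_last a2 s2.
have pX : path e a1 (rcons s1 beta) by rewrite rcons_path p1 l1.
have uX : beta \notin a1 :: s1 -> uniq (a1 :: rcons s1 beta).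
  by move=> bX; rewrite -rcons_cons rcons_uniq bX.
have mX z : z \in a1 :: rcons s1 beta = (z == beta) || (z \in a1 :: s1).
  by rewrite -rcons_cons mem_rcons inE.
case: (boolP (last a2 s2 \in B)) => [lB|lB].
  have bX : ~~ ((beta \in a1 :: s1) || (beta \in a2 :: s2)).
    by apply/negP => /hB; rewrite eqxx => /(_ isT) E; rewrite E lB in beB.
  case/norP: (bX) => bX1 bX2.
  exists a1, (rcons s1 beta), a2, s2; split; split; rewrite ?last_rcons ?uX //.
  - move=> z; rewrite mX => /orP [/eqP->|]; last exact: d12.
    by rewrite (negPf bX2).
  - move=> z; rewrite -cat_cons mem_cat mX -orbA => /orP [/eqP->|]; last exact: hA.
    by rewrite (negPf beA).
  - move=> z; rewrite -cat_cons mem_cat mX -orbA => /orP [/eqP->|zz zB].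
      by rewrite (negPf beB).
    by apply: hB; rewrite ?zB ?orbT.
have lE : last a2 s2 = beta by move: l2; rewrite !inE (negPf lB) orbF => /eqP.
have XYB z : (z \in a1 :: s1) || (z \in a2 :: s2) -> z \notin B.
  move=> zz; apply/negP => zB; move: (hB z zz); rewrite zB orbT => /(_ isT) E.
  by rewrite -E zB in lB.
have bX : beta \notin a1 :: s1.
  by apply/negP => bX; apply: (d12 _ bX); rewrite -lE.
(* Now the second link ends in [beta], and the first could be prolonged to [beta] as well. A path
   from [Z] to [B] that avoids [beta] replaces the tail of the link it leaves, and the other link
   keeps or gets the end [beta]. If it leaves from a vertex of [A] off both links, it replaces the
   link that starts in [A]. *)
pose Z := [set z | [|| z \in A, z \in a1 :: s1 | z \in a2 :: s2] & z != beta].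
have a1Z : a1 \in Z.
  by rewrite !inE eqxx orbT /=; apply: contraNneq bX => <-; rewrite mem_head.
have a1b : a1 != beta by move: a1Z; rewrite inE => /andP [].
have bb : b != beta by apply: contraNneq beB => <-.
have [w [s [[pw uw bw wZ lsB] [sZ sB]]]] := linking_path C2 a1Z bB a1b bb.
have sN z : z \in s -> [/\ z \notin A, z \notin a1 :: s1, z \notin a2 :: s2 & z != beta].
  move=> zs; have zb : z != beta by apply: contraNneq bw => <-; rewrite inE zs orbT.
  by have := sZ z zs; rewrite inE zb andbT !negb_or => /and3P [].
have us : uniq s by case/andP: uw.
move: wZ; rewrite inE => /andP [wZ wb].
case: (boolP (w \in a1 :: s1)) => [wX|wX].
  case/splitPl: wX u1 p1 l1 d12 hA hB XYB bX sN {l1X pX uX mX Z a1Z sZ wZ}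
    => q1 q2 lq u1 p1 l1 d12 hA hB XYB bX sN.
  have sub z : z \in a1 :: q1 -> z \in a1 :: q1 ++ q2.
    by rewrite -cat_cons mem_cat => ->.
  have mc z : z \in a1 :: q1 ++ s = (z \in a1 :: q1) || (z \in s).
    by rewrite -cat_cons mem_cat.
  exists a2, s2, a1, (q1 ++ s); split; split=> //.
  - by move: p1; rewrite !cat_path lq pw => /andP [-> _].
  - move: u1; rewrite -!cat_cons !cat_uniq us andbT => /andP [-> _] /=.
    apply/hasP => [[z /sN [_ zn _ _] zq]]; by rewrite sub in zn.
  - move=> z zY; rewrite mc => /orP [/sub zX|/sN [_ _]]; first exact: d12 zX zY.
    by rewrite zY.
  - by rewrite last_cat lq.
  - case: h12 => [[]|[]]; tauto.
  - move=> z; rewrite -cat_cons mem_cat mc orbA => /orP [zz|/sN [/negPf -> //]] zA.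
    have zz' : (z \in a1 :: q1 ++ q2) || (z \in a2 :: s2).
      by case/orP: zz => [->|/sub ->]; rewrite ?orbT.
    by case: (hA z zz' zA); tauto.
  - move=> z; rewrite last_cat lq -cat_cons mem_cat mc orbA => /orP [zz|zs] zB.
      have /XYB : (z \in a1 :: q1 ++ q2) || (z \in a2 :: s2).
        by case/orP: zz => [->|/sub ->]; rewrite ?orbT.
      by rewrite zB.
    by apply: sB => //; rewrite inE zs orbT.
have uXb := uX bX.
case: (boolP (w \in a2 :: s2)) => [wY|wY].
  case/splitPl: wY u2 p2 l2 lE d12 hA hB XYB sN {l2Y lB Z a1Z sZ wZ}
    => q1 q2 lq u2 p2 l2 lE d12 hA hB XYB sN.
  have sub z : z \in a2 :: q1 -> z \in a2 :: q1 ++ q2.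
    by rewrite -cat_cons mem_cat => ->.
  have mc z : z \in a2 :: q1 ++ s = (z \in a2 :: q1) || (z \in s).
    by rewrite -cat_cons mem_cat.
  have bq : beta \notin a2 :: q1.
    apply/negP => bq; move: u2; rewrite -cat_cons cat_uniq => /and3P [_ /hasPn hn _].
    move: lE; rewrite last_cat lq; case: (q2) hn => [|c q] hn /= lE.
      by rewrite lE eqxx in wb.
    by have := hn _ (mem_last c q); rewrite lE /= bq.
  exists a1, (rcons s1 beta), a2, (q1 ++ s); split; split=> //.
  - by move: p2; rewrite !cat_path lq pw => /andP [-> _].
  - move: u2; rewrite -!cat_cons !cat_uniq us andbT => /andP [-> _] /=.
    apply/hasP => [[z /sN [_ _ zn _] zq]]; by rewrite sub in zn.
  - move=> z; rewrite mX mc => /orP [/eqP->|zX].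
      by rewrite (negPf bq) /= => /sN [_ _ _]; rewrite eqxx.
    move=> /orP [/sub zY|/sN [_ zn _ _]]; first exact: d12 zX zY.
    by rewrite zX in zn.
  - by rewrite last_rcons.
  - by rewrite last_cat lq.
  - move=> z; rewrite -cat_cons mem_cat mc mX => /orP [/orP [/eqP->|zX]|/orP[/sub zY|/sN [/negPf -> //]]].
    + by rewrite (negPf beA).
    + by apply: hA; rewrite zX.
    + by apply: hA; rewrite zY orbT.
  - move=> z; rewrite last_cat lq -cat_cons mem_cat mc mX => /orP [/orP [/eqP->|zX]|/orP[/sub zY|zs]] zB.
    + by rewrite zB in beB.
    + by have := XYB z; rewrite zX zB => /(_ isT).
    + by have := XYB z; rewrite zY zB orbT => /(_ isT).
    + by apply: sB => //; rewrite inE zs orbT.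
have wA : w \in A by move: wZ; rewrite (negPf wX) (negPf wY) !orbF.
have wW z : z \in w :: s -> [/\ z \notin a1 :: s1, z \notin a2 :: s2 & z != beta].
  by rewrite inE => /orP [/eqP->|/sN []]; split.
case: h12 => [[h1 h2]|[h2 h1]].
- exists a1, (rcons s1 beta), w, s; split; split=> //.
  + by move=> z; rewrite mX => zX /wW [z1 z2 z3]; rewrite (negPf z1) (negPf z3) in zX.
  + by rewrite last_rcons.
  + by left.
  + move=> z; rewrite -cat_cons mem_cat mX => /orP [/orP [/eqP->|zX]|].
    * by rewrite (negPf beA).
    * move=> zA; case: (hA z _ zA) => [|->|E]; [by rewrite zX|by left|].
      by case: (d12 z zX); rewrite E mem_head.
    * by rewrite inE => /orP [/eqP->|/sN [/negPf -> //]]; right.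
  + move=> z; rewrite -cat_cons mem_cat mX => /orP [/orP [/eqP->|zX]|].
    * by rewrite (negPf beB).
    * by move=> zB; have := XYB z; rewrite zX zB => /(_ isT).
    * exact: sB.
- exists a2, s2, w, s; split; split=> //.
  + by move=> z zX /wW [z1 z2 z3]; rewrite zX in z2.
  + by left.
  + move=> z; rewrite -cat_cons mem_cat => /orP [zX|].
    * move=> zA; case: (hA z _ zA) => [|E|->]; [by rewrite zX orbT| |by left].
      by case: (d12 z _ zX); rewrite E mem_head.
    * by rewrite inE => /orP [/eqP->|/sN [/negPf -> //]]; right.
  + move=> z; rewrite -cat_cons mem_cat => /orP [zX|].
    * by move=> zB; have := XYB z; rewrite zX zB orbT => /(_ isT).
    * exact: sB.
Qed.

(* Walk from z back to x, then jump to the first neighbour of x behind z. *)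
Lemma detour x s z :
  path e x s -> uniq (x :: s) -> e x (last x s) -> z \in x :: s -> z != last x s ->
  exists t, [/\ path e z t, last z t = last x s, uniq (z :: t)
    & {subset z :: t <= x :: s}] /\ x \in z :: t /\
    (forall w, w \in x :: s -> e x w -> w \in z :: t).
Proof.
move=> ps us ex zs; case/splitPl: zs ps us ex => p1 p2 lz ps us ex zl.
have h2 : has (e x) p2.
  move: ex zl; rewrite last_cat lz.
  case/lastP: p2 {ps us} => [|p2 y]; first by rewrite /= eqxx.
  by rewrite last_rcons has_rcons => ->.
have [q1 [w [q2 [E2 xw nq1]]]] := split_first h2.
exists (rev (belast x p1) ++ w :: q2).
have mz y : y \in z :: rev (belast x p1) ++ w :: q2 = (y \in x :: p1) || (y \in w :: q2).
  by rewrite -cat_cons -lz rev_belast mem_cat mem_rev.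
move: ps us; rewrite E2 => ps us.
have /and3P [pp1 _ /= /andP [_ pq2]] : [&& path e x p1, path e (last x p1) q1 & path e (last (last x p1) q1) (w :: q2)].
  by rewrite -!cat_path.
have us' : uniq ((x :: p1) ++ q1 ++ w :: q2) by [].
rewrite !cat_uniq in us'; case/and3P: us' => [up1 hn /and3P [_ _ uq2]].
have mE y : y \in x :: p1 ++ q1 ++ w :: q2 = [|| y \in x :: p1, y \in q1 | y \in w :: q2].
  by rewrite -cat_cons !mem_cat.
have hn' y : y \in w :: q2 -> y \notin x :: p1.
  by move=> yq; move/hasPn: hn; apply; rewrite mem_cat yq orbT.
split; [split|split].
- by rewrite cat_path -lz path_rev /= last_rev pp1 xw pq2.
- by rewrite !last_cat.
- rewrite -[_ && _]/(uniq ((z :: rev (belast x p1)) ++ w :: q2)) -lz rev_belast cat_uniq rev_uniq up1 uq2 andbT.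
  by apply/hasPn => y yq; rewrite /= mem_rev hn'.
- move=> y; rewrite mz mE; by case/orP => ->; rewrite ?orbT.
- by rewrite mz mem_head.
- move=> y; rewrite mz mE => /or3P [->//|yq|->]; last by rewrite orbT.
  by move=> xy; case/hasP: nq1; exists y.
Qed.

(** * Closing a path to a long cycle *)

Lemma mem_last_nonempty (x : V) r : r != [::] -> last x r \in r.
Proof. by case/lastP: r => // s y _; rewrite last_rcons mem_rcons mem_head. Qed.

Definition long_cycle L : Prop :=
  exists2 r : seq V, (2 < size r) && ucycleb e r & L <= size r.

(** Two disjoint links join [alpha] and a vertex of [x :: A0] to [beta] and a vertex of [B0]. On
    either side a detour connects the two link ends through [x], respectively [y], and through all
    its neighbours on that side, so the resulting cycle collects both neighbourhoods. *)
Lemma noncrossing_cycle x A0 alpha u B0 :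
  biconnected -> let beta := last alpha u in let y := last beta B0 in
  path e x (A0 ++ alpha :: u ++ B0) -> uniq (x :: A0 ++ alpha :: u ++ B0) ->
  0 < size B0 -> e x alpha -> e y beta ->
  long_cycle (count (e x) (x :: A0 ++ [:: alpha]) + count (e y) (beta :: B0)).
Proof.
move=> C2 beta y pP uP B0n exa eyb.
pose A : {set V} := [set z in x :: A0]; pose B : {set V} := [set z in B0].
have pP' := pP; move: pP; rewrite cat_path /= => /and3P [pA ea]; rewrite cat_path -/beta => /andP [pu pB].
have uP' := uP; move: uP; rewrite -cat_cons -cat_cons cat_uniq => /and3P [uA nA].
rewrite cat_uniq => /and3P [uu nu uB].
have yB : y \in B0 by rewrite /y; case: (B0) B0n => //= c s _; exact: mem_last.
have AB z : z \in A -> z \in B -> False.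
  rewrite !inE => zA zB; move/hasPn: nA => /(_ z); rewrite mem_cat zB orbT inE => /(_ isT).
  by rewrite zA.
have uAB z : z \in alpha :: u -> (z \notin A) && (z \notin B).
  move=> zu; rewrite !inE; move/hasPn: nA => /(_ z); rewrite mem_cat zu inE /= => /(_ isT) -> /=.
  by apply/negP => zB; move/hasPn: nu => /(_ z zB); rewrite /= zu.
have xA : x \in A by rewrite !inE eqxx.
have yB' : y \in B by rewrite inE.
have [a1 [s1 [a2 [s2 [[p1 p2 u1 u2 d12] [l1 l2 h12 hA hB]]]]]] :=
  two_links C2 pu uu xA yB' AB uAB.
have alu : alpha \in alpha :: u by rewrite mem_head.
have beu : beta \in alpha :: u by rewrite mem_last.
have /andP [alA alB] := uAB _ alu; have /andP [beA beB] := uAB _ beu.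
have {}hA z : (z \in a1 :: s1) || (z \in a2 :: s2) -> (z == alpha) || (z \in A) -> z = a1 \/ z = a2.
  rewrite -mem_cat => zz /orP [/eqP->|]; last exact: hA.
  by case: h12 => [[-> _]|[-> _]]; tauto.
have {}hB z : (z \in a1 :: s1) || (z \in a2 :: s2) -> z \in B -> z = last a2 s2.
  by rewrite -mem_cat; apply: hB.
have a12 : a2 != a1 by apply/eqP => E; apply: (d12 a1); rewrite ?mem_head -?E ?mem_head.
(* [detour] runs from the link end in [A] to [alpha]. When it is the second link that starts in
   [alpha], the detour is reversed, so that [ta] always leads from [a2] to [a1]. *)
have [ta [[pta lta uta sta] [xta nta]]] : exists t, [/\ path e a2 t, last a2 t = a1, uniq (a2 :: t)
    & {subset a2 :: t <= x :: rcons A0 alpha}] /\ x \in a2 :: t /\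
    (forall w, w \in x :: rcons A0 alpha -> e x w -> w \in a2 :: t).
  have pA' : path e x (rcons A0 alpha) by rewrite rcons_path pA.
  have uA' : uniq (x :: rcons A0 alpha).
    by rewrite -rcons_cons rcons_uniq uA andbT; move: alA; rewrite inE.
  have eA' : e x (last x (rcons A0 alpha)) by rewrite last_rcons.
  case: h12 => [[h1 h2]|[h2 h1]].
    have [||t [[pt lt ut st] [xt nt]]] := detour pA' uA' eA' (z := a2).
    - by rewrite -rcons_cons mem_rcons inE; move: h2; rewrite inE => ->; rewrite orbT.
    - by rewrite last_rcons -h1.
    by exists t; split=> //; split=> //; rewrite lt last_rcons.
  have [||t [[pt lt ut st] [xt nt]]] := detour pA' uA' eA' (z := a1).
  - by rewrite -rcons_cons mem_rcons inE; move: h1; rewrite inE => ->; rewrite orbT.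
  - by rewrite last_rcons -h2 eq_sym.
  have E2 : last a1 t = a2 by rewrite lt last_rcons.
  exists (rev (belast a1 t)).
  have Er : a2 :: rev (belast a1 t) = rev (a1 :: t) by rewrite -rev_belast E2.
  rewrite Er rev_uniq mem_rev -{1 2}E2 path_rev last_rev; split; first split=> //.
    by move=> z; rewrite mem_rev; apply: st.
  by split=> // z; rewrite mem_rev; apply: nt.
have [tb [[ptb ltb utb stb] [ytb ntb]]] : exists t, [/\ path e beta t, last beta t = last a2 s2, uniq (beta :: t)
    & {subset beta :: t <= beta :: B0}] /\ y \in beta :: t /\
    (forall w, w \in beta :: B0 -> e y w -> w \in beta :: t).
  have ER : y :: rev (belast beta B0) = rev (beta :: B0) by rewrite -rev_belast.
  have pB' : path e y (rev (belast beta B0)) by rewrite path_rev.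
  have uB' : uniq (y :: rev (belast beta B0)).
    by rewrite ER rev_uniq /= uB andbT; move: beB; rewrite inE.
  have lB : last y (rev (belast beta B0)) = beta by rewrite last_rev.
  have eB' : e y (last y (rev (belast beta B0))) by rewrite lB.
  have [||t [[pt lt ut st] [yt nt]]] := detour pB' uB' eB' (z := last a2 s2).
  - by rewrite ER mem_rev inE; move: l2; rewrite inE => ->; rewrite orbT.
  - by rewrite lB; apply: contraNneq beB => <-.
  have E2 : last (last a2 s2) t = beta by rewrite lt lB.
  exists (rev (belast (last a2 s2) t)).
  have Er : beta :: rev (belast (last a2 s2) t) = rev (last a2 s2 :: t) by rewrite -rev_belast E2.
  rewrite Er rev_uniq mem_rev -{1 2}E2 path_rev last_rev; split; first split=> //.
    by move=> z; rewrite mem_rev => /st; rewrite ER mem_rev.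
  by split=> // z; rewrite mem_rev => zz; apply: nt; rewrite ER mem_rev.
have staA z : z \in a2 :: ta -> (z == alpha) || (z \in A).
  by move/sta; rewrite -rcons_cons mem_rcons inE => /orP [->//|zA]; rewrite [z \in A]inE zA orbT.
have stbB z : z \in tb -> (z != beta) && (z \in B).
  move=> zt; have := stb z; rewrite inE zt orbT => /(_ isT); rewrite !inE.
  by case: eqP => [E|_] //=; move: utb; rewrite /= -E zt.
(* The closed walk from [a1]: along the first link to [beta], over to the end of the second link,
   back along it to [a2], and home by [ta]. The vertex [a1] is listed once, as the last entry. *)
pose w := s1 ++ tb ++ rev (belast a2 s2).
pose r := w ++ ta.
have lw : last a1 w = a2 by rewrite !last_cat l1 ltb last_rev.
have lr : last a1 r = a1 by rewrite last_cat lw.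
have ta0 : ta != [::] by apply/eqP => E; move: lta a12; rewrite E /= => ->; rewrite eqxx.
have pr : path e a1 r.
  by rewrite !cat_path p1 !last_cat l1 ptb ltb path_rev p2 last_rev pta.
have r0 : r != [::] by rewrite /r; case: (w) => //.
have a1r : a1 \in r by rewrite -{1}lr mem_last_nonempty.
have a1rE z : z \in a1 :: r -> z \in r by rewrite inE => /orP [/eqP->|].
have s2b z : z \in belast a2 s2 -> (z \in a2 :: s2) && (z != last a2 s2).
  move=> zb; rewrite lastI mem_rcons inE zb orbT; apply: contraTneq zb => ->.
  by move: u2; rewrite lastI rcons_uniq => /andP [].
have ur : uniq r.
  have u1' : uniq s1 by case/andP: u1.
  have utb' : uniq tb by case/andP: utb.
  have uta' : uniq ta by case/andP: uta.
  have u2' : uniq (belast a2 s2) by move: u2; rewrite lastI rcons_uniq => /andP [].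
  rewrite /r /w !cat_uniq u1' utb' uta' rev_uniq u2' !andbT /=.
  apply/andP; split; last first.
    apply/hasPn => z zt; rewrite !mem_cat mem_rev /=.
    have zA : (z == alpha) || (z \in A) by apply: staA; rewrite inE zt orbT.
    have z2 : z <> a2 by move=> E; move: uta; rewrite /= -E zt.
    apply/negP => /or3P [z1|/stbB /andP [z1 z3]|/s2b /andP [z1 _]].
    - have [] := hA z _ zA; rewrite ?inE ?z1 ?orbT // => E.
      by move: u1; rewrite /= -E z1.
    - by case/orP: zA => [/eqP E|zA]; [rewrite E (negPf alB) in z3|exact: AB zA z3].
    - have [] := hA z _ zA; rewrite ?z1 ?orbT // => E.
      by apply: (d12 z); rewrite ?z1 // E mem_head.
  apply/andP; split; last first.
    apply/hasPn => z; rewrite mem_rev => /s2b /andP [z1 z2]; apply/negP => /= /stbB /andP [z3 z4].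
    by case/eqP: z2; apply: hB z4; rewrite z1 orbT.
  apply/hasPn => z; rewrite mem_cat mem_rev => /orP [/stbB /andP [z1 z2]|/s2b /andP [z1 z2]];
    apply/negP => /= z3; have z3' : z \in a1 :: s1 by rewrite inE z3 orbT.
  - have E : z = last a2 s2 by apply: hB z2; rewrite z3'.
    by apply: (d12 z) => //; rewrite E mem_last.
  - exact: d12 z3' z1.
have TAr z : z \in a2 :: ta -> z \in r.
  rewrite inE => /orP [/eqP->|zt]; last by rewrite mem_cat zt orbT.
  apply: a1rE; have := mem_last a1 w; rewrite lw !inE => /orP [->//|zw].
  by rewrite mem_cat zw orbT.
have TBr z : z \in beta :: tb -> z \in r.
  rewrite inE => /orP [/eqP->|zt]; last by rewrite !mem_cat zt orbT.
  apply: a1rE; have := mem_last a1 s1; rewrite l1 -/beta !inE => /orP [->//|zw].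
  by rewrite !mem_cat zw orbT.
have xr := TAr _ xta; have yr := TBr _ ytb.
have ucr : ucycleb e r by rewrite /ucycleb ur andbT; apply: closed_walk_cycle pr lr r0.
have xNB z : z \in B0 -> z \notin x :: rcons A0 alpha.
  move=> zB; have zB' : z \in B by rewrite inE.
  rewrite -rcons_cons mem_rcons inE negb_or; apply/andP; split.
    by apply: contraTneq zB' => ->.
  by apply/negP => zA; apply: (AB z) => //; rewrite inE.
have alr : alpha \in r.
  apply: TAr; apply: nta => //; by rewrite -rcons_cons mem_rcons mem_head.
exists r; first rewrite ucr andbT.
  have := @uniq_leq_size _ [:: x; alpha; y] r; apply.
    rewrite /= !inE !andbT negb_or -andbA; apply/and3P; split.
    - by apply: contraNneq alA => <-.
    - by apply: contraTneq (xNB y yB) => <-; rewrite mem_head.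
    - by apply: contraNneq alB => ->.
  by move=> z; rewrite !inE => /or3P [] /eqP ->.
(* The extra entry [x] makes up for [beta], which is left out of the second list: if [u] is empty,
   [beta] is [alpha] and already stands in the first. *)
pose l1' := x :: filter (e x) (rcons A0 alpha); pose l2' := filter (e y) B0.
have sl1 : size l1' = (count (e x) (x :: A0 ++ [:: alpha])).+1.
  by rewrite /l1' /= size_filter e_irr cats1.
have sl2 : count (e y) (beta :: B0) = (size l2').+1 by rewrite /= size_filter eyb.
have -> : count (e x) (x :: A0 ++ [:: alpha]) + count (e y) (beta :: B0) = size (l1' ++ l2').
  by rewrite size_cat sl2 sl1 addSn addnS.
have ux : uniq (x :: rcons A0 alpha).
  by rewrite -rcons_cons rcons_uniq uA andbT; move: alA; rewrite inE.
have l1sub z : z \in l1' -> z \in x :: rcons A0 alpha /\ (z == x \/ e x z).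
  rewrite inE mem_filter => /orP [/eqP->|/andP [ez zA]]; first by rewrite mem_head; split=> //; left.
  by rewrite inE zA orbT; split=> //; right.
apply: uniq_leq_size.
  have ul1 : uniq l1'.
    move: ux => /= /andP [ux1 ux2]; rewrite filter_uniq // andbT.
    by rewrite mem_filter negb_and ux1 orbT.
  rewrite cat_uniq ul1 filter_uniq ?andbT //.
  by apply/hasPn => z; rewrite mem_filter => /andP [_ /xNB zn]; apply: contra zn => /l1sub [].
move=> z; rewrite mem_cat => /orP [/l1sub [zA [/eqP->//|ez]]|].
  by apply: TAr; apply: nta.
rewrite mem_filter => /andP [ez zB]; apply: TBr; apply: ntb => //.
by rewrite inE zB orbT.
Qed.

(** The cycle runs along [P1], crosses to the end of the path, returns along [D] to [w] and from
    there to [x]; it misses exactly [M]. *)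
Lemma crossing_cycle x P1 M w D :
  path e x (P1 ++ M ++ w :: D) -> uniq (x :: P1 ++ M ++ w :: D) ->
  e x w -> e (last w D) (last x P1) ->
  exists2 r, ucycleb e r & size r = (size P1 + size D).+2.
Proof.
rewrite !cat_path => /and3P [p1 _ /= /andP [_ pD]] uP xw yP.
pose r := rev (belast w D) ++ (x :: P1) ++ [:: last w D].
have Er : perm_eq r (rev (w :: D) ++ (x :: P1)).
  by rewrite /r -rev_belast cats1 -rcons_cat perm_rcons.
exists r; last by rewrite (perm_size Er) size_cat size_rev /= addSn addnS addnC.
rewrite /ucycleb (perm_uniq Er); apply/andP; split.
  apply: (closed_walk_cycle (x := last w D)).
  - by rewrite cat_path path_rev pD last_rev /= e_sym xw cat_path p1 /= e_sym yP.
  - by rewrite !last_cat.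
  - by rewrite /r; case: (rev _).
rewrite uniq_catC cat_uniq rev_uniq.
have : uniq ((x :: P1) ++ M ++ w :: D) by [].
rewrite cat_uniq => /and3P [-> hn]; rewrite cat_uniq => /and3P [_ _ ->]; rewrite andbT.
apply/hasPn => z; rewrite mem_rev => zD.
by move/hasPn: hn => /(_ z); rewrite mem_cat zD orbT; apply.
Qed.

Lemma leq_sum_const (f : nat -> nat) a b : (forall l, a <= l < b -> f l <= 1) ->
  \sum_(a <= l < b) f l <= b - a.
Proof.
move=> fl; rewrite -[b - a]muln1 -sum_nat_const_nat big_nat_cond [leqRHS]big_nat_cond.
by apply: leq_sum => l; rewrite andbT; apply: fl.
Qed.

Lemma count_sum_nth x (p : pred V) s : count p s = \sum_(0 <= l < size s) p (nth x s l).
Proof. by rewrite -sum1_count (big_nth x) big_mkcond; apply: eq_bigr => l _; case: (p _). Qed.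

(* Among the pairs i < j with the i-th vertex adjacent to the last one and the
   j-th vertex adjacent to the first one, the closest pair closes up to a long
   cycle; if there is no such pair, 2-connectivity provides two disjoint links
   around the middle part. *)
Lemma path_long_cycle L x s :
  biconnected -> path e x s -> uniq (x :: s) -> 1 < size s -> L <= (size s).+1 ->
  L <= count (e x) (x :: s) + count (e (last x s)) (x :: s) -> long_cycle L.
Proof.
move=> C2 ps us s2 Ls Lc; set y := last x s in Lc.
pose v i := nth x (x :: s) i.
have vS i : v i.+1 = nth x s i by [].
have v0 : v 0 = x by [].
have vy : v (size s) = y by rewrite /v -last_nth.
have vm i : i < size s -> e (v i) (v i.+1).
  by move=> ism; have /(pathP x) := ps; apply.
have v1 : e x (v 1) by apply: (vm 0); lia.
have lt_take i : i <= size s -> last x (take i s) = v i.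
  move=> im; rewrite (last_nth x) size_takel //.
  by rewrite -[x :: _]/(take i.+1 (x :: s)) nth_take.
pose cross d := [exists i : 'I_(size s).+1, [&& 0 < d, i + d <= size s, e y (v i) & e x (v (i + d))]].
have crossI i j : i < j -> j <= size s -> e y (v i) -> e x (v j) -> cross (j - i).
  move=> ij js yi xj; apply/existsP.
  have im : i < (size s).+1 by lia.
  by exists (Ordinal im); rewrite /= subnKC ?(ltnW ij) // yi xj js subn_gt0 ij.
case: (boolP [exists d : 'I_(size s).+1, cross d]) => [|nc].
  case/existsP=> d0 cd0.
  have ex : exists d, cross d by exists d0.
  case: (ex_minnP ex) => d cd dmin.
  case/existsP: (cd) => [[i im]] /= /and4P [d_gt0 ids yi xj].
  pose j := i + d; have jd : j = i + d by []; rewrite -/j in ids xj.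
  have nox l : i < l < j -> e x (v l) = false.
    move=> /andP [il lj]; apply/negP => xl; have ls : l <= size s by lia.
    by have := dmin _ (crossI i l il ls yi xl); lia.
  have noy l : i < l < j -> e y (v l) = false.
    move=> /andP [il lj]; apply/negP => yl.
    by have := dmin _ (crossI l j lj ids yl xj); lia.
  have jE : j.-1.+1 = j by lia.
  have [||||r ur sr] := @crossing_cycle x (take i s) (take (d.-1) (drop i s)) (v j) (drop j s).
  - have -> : v j :: drop j s = drop j.-1 s.
      rewrite -jE vS; case: (j) jE ids => // j' _ js /=.
      by rewrite -drop_nth.
    have -> : drop j.-1 s = drop d.-1 (drop i s) by rewrite drop_drop; congr drop; lia.
    by rewrite !cat_take_drop.
  - have -> : v j :: drop j s = drop j.-1 s.
      rewrite -jE vS; case: (j) jE ids => // j' _ js /=.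
      by rewrite -drop_nth.
    have -> : drop j.-1 s = drop d.-1 (drop i s) by rewrite drop_drop; congr drop; lia.
    by rewrite !cat_take_drop.
  - exact: xj.
  - rewrite lt_take ?ltnS // -?ltnS //.
    have -> : last (v j) (drop j s) = y; last exact: yi.
    rewrite /y -{2}(cat_take_drop j s) last_cat lt_take //.
  rewrite size_drop size_takel in sr; last by lia.
  (* A crossing pair that involves an end of the path forces [d = 1], because [x] is adjacent to the
     second vertex and [y] to the last but one. Hence the cycle has more than two vertices in every
     case. *)
  have cross1 : 0 < i \/ d = 1.
    case: (posnP i) => [i0|]; [right|by left].
    have := dmin 1; have -> : cross 1.
      by apply: (crossI 0 1); rewrite ?v0 //; [lia|move: yi; rewrite i0].
    by move=> /(_ isT); lia.
  have cross2 : j < size s \/ d = 1.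
    case: (ltnP j (size s)) => [|sj]; [by left|right].
    have js : j = size s by lia.
    have := dmin 1; have -> : cross 1.
      have -> : 1 = size s - (size s).-1 by lia.
      apply: crossI; rewrite ?vy //; try lia; last by rewrite -vy -js.
      have := @vm (size s).-1; rewrite prednK ?vy; last by lia.
      by rewrite e_sym; apply; lia.
    by move=> /(_ isT); lia.
  exists r; rewrite sr; first by rewrite ur andbT; lia.
  case: (ltnP 1 d) => d1; last by lia.
  apply: leq_trans Lc _.
  rewrite !(count_sum_nth x) /= big_nat_recl // [X in _ + X <= _]big_nat_recr //=.
  rewrite -/(v (size s)) vy !e_irr add0n addn0 -big_split /=.
  (* A neighbour of [x] in position [l.+1] is paired with a neighbour of [y] in position [l]. As
     [d > 1], no pair is full, and for [i < l < j] only [l = j - 1] contributes. So the sum is at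
     most the length of the cycle found. *)
  pose f l := e x (nth x s l) + e y (v l).
  rewrite -[X in X <= _]/(\sum_(0 <= l < size s) f l).
  have f1 l : l < size s -> f l <= 1.
    move=> ls; rewrite /f -/(v l).
    case: (boolP (e x (nth x s l))) => xl; case: (boolP (e y (v l))) => yl //.
    have := dmin _ (crossI l l.+1 (ltnSn l) ls yl xl); lia.
  rewrite (@big_cat_nat _ _ _ i.+1) //=; last by lia.
  rewrite (@big_cat_nat _ _ _ j i.+1) //=; [|by lia..].
  have h1 : \sum_(0 <= l < i.+1) f l <= i.+1 - 0.
    by apply: leq_sum_const => l /andP [_ li]; apply: f1; lia.
  have h3 : \sum_(j <= l < size s) f l <= size s - j.
    by apply: leq_sum_const => l /andP [_ li]; apply: f1; lia.
  have h2 : \sum_(i.+1 <= l < j) f l <= 1.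
    rewrite -jE big_nat_recr /=; last by lia.
    rewrite big_nat_cond big1 ?add0n; first by apply: f1; lia.
    move=> l /andP [/andP [il lj] _]; rewrite /f -/(v l) -vS nox ?noy //; lia.
  by rewrite addnA; lia.
have nocross i j : i < j -> j <= size s -> e y (v i) -> e x (v j) -> False.
  move=> ij js yi xj; case/existsP: nc; have dm : j - i < (size s).+1 by lia.
  by exists (Ordinal dm); apply: crossI.
(* [alpha] will be the last neighbour of [x] and [beta] the first neighbour of [y]. Without a
   crossing pair [alpha] does not come after [beta], but the two may coincide. *)
have hx : has (e x) s.
  by apply/hasP; exists (v 1) => //; rewrite vS mem_nth // ltnW.
have [A0 [alpha [R [sE xal nR]]]] := split_last hx.
have nyA z : z \in x :: A0 -> ~~ e y z.
  move=> zA; apply/negP => yz.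
  have iz : index z (x :: A0) < size (x :: A0) by rewrite index_mem.
  apply: (nocross (index z (x :: A0)) (size A0).+1) => //.
  - by rewrite sE size_cat /=; lia.
  - by rewrite /v sE -cat_cons nth_cat iz nth_index.
  - by rewrite vS sE nth_cat ltnn subnn.
have ylast : y = last alpha R by rewrite /y sE last_cat.
have hy : has (e y) (alpha :: R).
  have := @vm (size s).-1; rewrite prednK ?vy; last by lia.
  rewrite e_sym => yv; apply/hasP; exists (v (size s).-1); last by apply: yv; lia.
  have : v (size s).-1 \in (x :: A0) ++ alpha :: R.
    by rewrite cat_cons -sE mem_nth //= ltnS leq_pred.
  rewrite mem_cat => /orP [/nyA|//]; rewrite yv // prednK // ltnW.
have [q1 [beta [B0 [RE yb nq1]]]] := split_first hy.
have [u uE lu] : exists2 u, alpha :: R = alpha :: u ++ B0 & last alpha u = beta.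
  case: q1 RE {nq1} => [[E1 E2]|c q1 [_ E2]]; first by exists [::]; rewrite /= ?E1 ?E2.
  by exists (rcons q1 beta); rewrite ?last_rcons // E2 cat_rcons.
have B0n : 0 < size B0.
  case: B0 RE uE => // RE uE.
  move: yb; rewrite ylast -lu -[last alpha R]/(last alpha (alpha :: R)) uE /= cats0.
  by rewrite e_irr.
case: uE => RuE; have sE' : s = A0 ++ alpha :: u ++ B0 by rewrite sE RuE.
have yE : last beta B0 = y by rewrite ylast RuE last_cat lu.
have := @noncrossing_cycle x A0 alpha u B0 C2.
rewrite /= lu yE -sE' => /(_ ps us B0n xal yb) [r ur sr].
exists r => //; apply: leq_trans Lc _; apply: leq_trans sr.
apply: leq_add.
  have cR : count (e x) R = 0 by apply/eqP; rewrite -leqn0 leqNgt -has_count.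
  by rewrite sE /= !count_cat /= cR.
have -> : x :: s = (x :: A0) ++ q1 ++ beta :: B0 by rewrite cat_cons -RE -sE.
rewrite !count_cat.
have /eqP -> : count (e y) (x :: A0) == 0.
  by rewrite -leqn0 leqNgt -has_count; apply/hasPn.
by move: nq1; rewrite has_count -leqNgt leqn0 => /eqP ->.
Qed.

End Graph.

(** * Saturated graphs and their cores *)

Definition no_cycle_above (V : finType) (e : rel V) c : Prop :=
  forall r : seq V, 2 < size r -> ucycleb e r -> size r <= c.

(** The edge [xy] would close this path to a cycle on more than [c] vertices. Edge-maximality is
    exploited through this consequence only, so it serves as the definition. *)
Definition saturated (V : finType) (e : rel V) c : Prop :=
  forall x y, x != y -> ~~ e x y ->
  exists s, [/\ path e x s, uniq (x :: s), last x s = y & c <= size s].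

Lemma no_cycle_aboveP (V : finType) (e : rel V) c :
  reflect (no_cycle_above e c)
    [forall l : 'I_#|V|.+1, forall p : l.-tuple V, (2 < l) && ucycleb e p ==> (l <= c)].
Proof.
apply: (iffP forallP) => [h r r2 ur|h l]; last first.
  by apply/forallP => p; apply/implyP => /andP [l2 up]; have := h p; rewrite size_tuple; apply.
have rV : size r < #|V|.+1 by rewrite ltnS; case/andP: ur => _ /card_uniqP <-; exact: max_card.
have /forallP /(_ (in_tuple r)) := h (Ordinal rV).
by rewrite /= r2 ur.
Qed.

(** Some step of the cycle is not in [e], hence is the added edge. A cycle on more than two vertices
    uses this edge once, so its other steps form a path between [x] and [y]. *)
Lemma cycle_added_edge (V : finType) (e : rel V) x y r :
  symmetric e -> 2 < size r -> ~~ cycle e r ->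
  ucycleb [rel u v | e u v || [|| (u == x) && (v == y) | (u == y) && (v == x)]] r ->
  exists s, [/\ path e x s, uniq (x :: s), last x s = y & size r = (size s).+1].
Proof.
set e' := [rel u v | _] => e_sym r2 nr /andP [cr ur].
have [u ur' nu] : exists2 u, u \in r & ~~ e u (next r u).
  apply/hasP; apply: contraNT nr; rewrite -all_predC => /allP h.
  by apply: cycle_from_next => // u /h /=; rewrite negbK.
have e'u := next_cycle cr ur'.
have [i s rE] := rot_to ur'.
have sr : size r = (size s).+1 by rewrite -(size_rot i) rE.
have us : uniq (u :: s) by rewrite -rE rot_uniq.
have cs : cycle e' (u :: s) by rewrite -rE rot_cycle.
have nE : next r u = next (u :: s) u by rewrite -rE next_rot.
case: s sr us cs nE rE => [|w [|t s]]; try by move=> sr; rewrite sr in r2.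
move=> sr us cs nE rE.
have {}nE : next r u = w by rewrite nE /= eqxx.
rewrite nE in nu e'u.
have pu : path e w (rcons (t :: s) u).
  move: cs => /= /and3P [_ wt ps].
  move: (us) => /= /and3P []; rewrite !inE !negb_or => /and3P [uw ut us'] /andP [wt' ws'] _.
  have badE a b : e' a b -> (a, b) != (u, w) -> (a, b) != (w, u) -> e a b.
    move=> /orP [//|ab]; move: e'u; rewrite /= (negPf nu) /= => uw'.
    rewrite !xpair_eqE => n1 n2; exfalso; move: n1 n2.
    by case/orP: uw' => /andP [/eqP-> /eqP->]; case/orP: ab => /andP [/eqP-> /eqP->]; rewrite !eqxx //= ?andbT.
  rewrite /= badE //=; last first.
  - by rewrite xpair_eqE eqxx eq_sym.
  - by rewrite xpair_eqE eq_sym (negPf uw).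
  have sub : {in predC1 w &, subrel e' e}.
    move=> a b; rewrite !inE => aw bw ab; apply: badE => //; rewrite xpair_eqE negb_and.
      by rewrite bw orbT.
    by rewrite aw.
  apply: (sub_in_path sub) ps; apply/allP => a.
  rewrite -rcons_cons mem_rcons !inE => /or3P [/eqP->//|/eqP->|].
    by rewrite eq_sym.
  by apply: contraTneq => ->.
have uu : uniq (w :: rcons (t :: s) u).
  by rewrite -rcons_cons rcons_uniq -/(uniq (u :: w :: t :: s)).
move: e'u; rewrite /= (negPf nu) /= => /orP [] /andP [/eqP Eu /eqP Ew].
- exists (rev (belast w (rcons (t :: s) u))); rewrite -Eu -Ew.
  have E : u = last w (rcons (t :: s) u) by rewrite last_rcons.
  split; last by rewrite size_rev size_belast size_rcons.
  - by rewrite {1}E path_rev.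
  - rewrite -[is_true _]/(is_true (uniq (u :: rev (belast w (rcons (t :: s) u))))).
    by rewrite {1}E rev_belast rev_uniq.
  - by rewrite {1}E last_rev.
- by exists (rcons (t :: s) u); rewrite -Eu -Ew last_rcons size_rcons.
Qed.

Lemma saturate (V : finType) (e : rel V) c :
  symmetric e -> irreflexive e -> no_cycle_above e c ->
  exists e' : rel V, [/\ symmetric e', irreflexive e', subrel e e',
    no_cycle_above e' c & saturated e' c].
Proof.
have [N] := ubnP #|[set p : V * V | ~~ e p.1 p.2]|.
elim: N e => // N IHN e eN e_sym e_irr hc.
pose add x y : rel V := [rel u v | e u v || [|| (u == x) && (v == y) | (u == y) && (v == x)]].
case: (boolP [exists p : V * V, [&& p.1 != p.2, ~~ e p.1 p.2 &
  [forall l : 'I_#|V|.+1, forall q : l.-tuple V, (2 < l) && ucycleb (add p.1 p.2) q ==> (l <= c)]]]).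
  case/existsP=> [[x y]] /= /and3P [xy nxy /no_cycle_aboveP hc'].
  have [|||e' [e's e'i e'sub e'c e's']] := IHN (add x y) _ _ _ hc'.
  - rewrite -ltnS; apply: leq_trans eN; apply: proper_card; apply/properP; split.
      by apply/subsetP => [[u v]]; rewrite !inE /= negb_or => /andP [].
    by exists (x, y); rewrite !inE /add /= ?nxy // !eqxx orbT.
  - move=> u v; rewrite /add /= e_sym; congr (_ || _).
    by rewrite [LHS]orbC; congr (_ || _); rewrite andbC.
  - move=> u; rewrite /add /= e_irr /=; apply/negP => /orP [] /andP [/eqP -> h].
      by rewrite h in xy.
    by rewrite eq_sym h in xy.
  by exists e'; split=> // u v uv; apply: e'sub; rewrite /add /= uv.
move=> none; exists e; split=> // x y xy nxy.
case: (boolP [forall l : 'I_#|V|.+1, forall q : l.-tuple V, (2 < l) && ucycleb (add x y) q ==> (l <= c)]).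
  by move=> h; case/existsP: none; exists (x, y); rewrite /= xy nxy.
case/forallPn => l /forallPn [p]; rewrite negb_imply -ltnNge => /andP [/andP [l2 up] cl].
have lp : size p = l by rewrite size_tuple.
case: (boolP (cycle e p)) => cp.
  have := hc p; rewrite lp l2 /ucycleb cp; case/andP: up => _ -> /(_ isT isT) lc.
  by rewrite ltnNge lc in cl.
have [|s [ps us ls ss]] := cycle_added_edge e_sym _ cp up; first by rewrite lp.
by exists s; split=> //; rewrite -ltnS -ss lp.
Qed.

(** * Dense sets and cores of saturated graphs *)

Section Core.
Variables (V : finType) (e : rel V).
Hypotheses (e_sym : symmetric e) (e_irr : irreflexive e).

Definition degree_in (S : {set V}) x := #|[set y in S | e x y]|.

Lemma degree_in_subset (S T : {set V}) x : S \subset T -> degree_in S x <= degree_in T x.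
Proof.
move=> ST; apply: subset_leq_card; apply/subsetP => y; rewrite !inE => /andP [yS ->].
by rewrite (subsetP ST).
Qed.

Lemma degree_in_count (S : {set V}) x p :
  (forall z, z \in S -> e x z -> z \in p) -> degree_in S x <= count (e x) p.
Proof.
move=> h; rewrite -size_filter /degree_in cardE; apply: uniq_leq_size; first exact: enum_uniq.
by move=> z; rewrite mem_enum inE mem_filter => /andP [zS ez]; rewrite ez h.
Qed.

(** A neighbour off the path becomes its new end. An edge from it to the far end would close a cycle
    on [size s + 2] vertices, which is more than [c]; so the ends stay nonadjacent. *)
Lemma extend_path c (A : {set V}) x s :
  no_cycle_above e c -> path e x s -> uniq (x :: s) -> 0 < size s -> c <= size s ->
  (forall z, z \in A -> e x z -> z \in x :: s) \/
  exists z, [/\ z \in A, path e z (x :: s), uniq (z :: x :: s), z != last x s & ~~ e z (last x s)].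
Proof.
move=> hc ps us s0 cs.
case: (boolP [forall z in A, e x z ==> (z \in x :: s)]) => [/forall_inP h|].
  by left=> z zA xz; have := h z zA; rewrite xz.
case/forall_inPn => z zA; rewrite negb_imply => /andP [xz zn]; right; exists z.
have pz : path e z (x :: s) by rewrite /= e_sym xz.
have uz : uniq (z :: x :: s) by rewrite /= zn.
split=> //; first by apply: contraNneq zn => ->; exact: mem_last.
apply/negP => zy.
have : size (z :: x :: s) <= c.
  apply: hc => //; rewrite /ucycleb uz andbT.
  by rewrite /cycle rcons_path pz /= e_sym.
by rewrite /= => h; lia.
Qed.

(** The path that saturation gives for a nonadjacent pair is prolonged by vertices of [A] at one end
    and of [B] at the other. When neither end can be prolonged, at least [a] and [b] neighbours of
    the ends lie on the path, and [path_long_cycle] with [L = c + 1] yields a forbidden cycle. *)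
Lemma dense_sets_joined c (A B : {set V}) a b :
  biconnected e -> saturated e c -> no_cycle_above e c ->
  (forall x, x \in A -> a <= degree_in A x) ->
  (forall y, y \in B -> b <= degree_in B y) -> c < a + b ->
  forall x y, x \in A -> y \in B -> x != y -> e x y.
Proof.
move=> C2 sat hc dA dB cab x0 y0 xA0 yB0 xy0; apply/negPn/negP => nxy0.
(* This replaces the choice of a longest path: such paths would exist in every length, which is
   absurd for [n = #|V|]. *)
suff grow n : exists x s, [/\ x \in A, last x s \in B, path e x s, uniq (x :: s) & ~~ e x (last x s)]
    /\ [/\ x != last x s, c <= size s & n <= size s].
  have [x [s [[_ _ _ us _] [_ _ big]]]] := grow #|V|.
  have := max_card (mem (x :: s)); by rewrite (card_uniqP us) leqNgt ltnS big.
elim: n => [|n [x [s [[xA yB ps us nxy] [xy cs ns]]]]].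
  have [s [ps us ls cs]] := sat x0 y0 xy0 nxy0.
  by exists x0, s; rewrite ls.
have s1 : 1 < size s.
  by case: (s) xy nxy ps => [|z [|//]] /=; [rewrite eqxx|move=> _ /negPf ->].
have [hx|[z [zA pz uz zy nzy]]] := extend_path A hc ps us (ltnW s1) cs; last first.
  by exists z, (x :: s); split; split; rewrite // ltnW.
pose s' := rev (belast x s); pose y := last x s.
have ys' : y :: s' = rev (x :: s) by rewrite /s' rev_belast.
have ps' : path e y s' by rewrite path_rev.
have us' : uniq (y :: s') by rewrite ys' rev_uniq.
have ss' : size s' = size s by rewrite size_rev size_belast.
have ls' : last y s' = x by rewrite last_rev.
have [||hy|[z [zB pz uz zx nzx]]] := extend_path B hc ps' us'; rewrite ?ss' //; first exact: ltnW.
  have [|r /andP [r2 ur] cr] := path_long_cycle e_sym e_irr C2 ps us s1 (L := c.+1) cs.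
    apply: leq_trans cab _; apply: leq_add.
      exact: leq_trans (dA x xA) (degree_in_count hx).
    apply: leq_trans (dB y yB) _; apply: degree_in_count => z zB yz.
    by have := hy z zB yz; rewrite ys' mem_rev.
  by have := hc r r2 ur; rewrite leqNgt cr.
rewrite ls' in zx nzx.
exists x, (rev (belast z (y :: s'))).
have Er : x :: rev (belast z (y :: s')) = rev (z :: y :: s') by rewrite -rev_belast /= ls'.
have lr : last x (rev (belast z (y :: s'))) = z by rewrite last_rev_belast.
rewrite lr Er rev_uniq size_rev size_belast /= ss'; split; split=> //; try by rewrite ltnW.
- have Ex : x = last z (y :: s') by rewrite /= ls'.
  by rewrite [X in path _ X _]Ex path_rev.
- by rewrite e_sym.
- by rewrite eq_sym.
Qed.

(* The largest vertex set inducing a subgraph of minimum degree above t: what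
   survives Kopylov's t-disintegration. *)
Definition core t : {set V} :=
  \bigcup_(S : {set V} | [forall x in S, t < degree_in S x]) S.

Lemma core_max t (S : {set V}) : (forall x, x \in S -> t < degree_in S x) -> S \subset core t.
Proof. by move=> h; apply: bigcup_sup; apply/forall_inP. Qed.

Lemma core_degree t x : x \in core t -> t < degree_in (core t) x.
Proof.
case/bigcupP => S dS xS; apply: leq_trans (forall_inP dS x xS) _.
by apply: degree_in_subset; apply: bigcup_sup.
Qed.

Lemma core_antimono t t' : t <= t' -> core t' \subset core t.
Proof. by move=> tt; apply: core_max => x /core_degree; apply: leq_ltn_trans. Qed.

(** Otherwise [S] itself would lie in the core by [core_max]. Hence the disintegration cannot get
    stuck before it reaches the core. *)
Lemma low_degree_vertex t (S : {set V}) : core t \proper S ->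
  exists2 v, v \in S & degree_in S v <= t.
Proof.
case/properP => sub [z zS zn].
case: (boolP [exists v in S, degree_in S v <= t]) => [/exists_inP [v]|none]; first by exists v.
case/negP: zn; apply: (subsetP (core_max _)) zS => x xS.
by rewrite ltnNge; apply: contra none => xt; apply/exists_inP; exists x.
Qed.

Lemma clique_cycle (K : {set V}) : 2 < #|K| ->
  {in K &, forall x y, x != y -> e x y} ->
  exists2 r, ucycleb e r & size r = #|K|.
Proof.
move=> K2 cl; exists (enum K); last by rewrite -cardE.
have uK := enum_uniq K.
rewrite /ucycleb uK andbT; apply: cycle_from_next => // x xK.
have nK : next (enum K) x \in enum K by rewrite mem_next.
have [i s rE] := rot_to xK.
rewrite !mem_enum in xK nK; apply: cl => //.
have us : uniq (x :: s) by rewrite -rE rot_uniq.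
have ss : #|K| = (size s).+1 by rewrite cardE -(size_rot i) rE.
rewrite -(next_rot i) // rE /=.
case: s us ss {rE} => [|y s] /= us ss; first by rewrite ss in K2.
by rewrite eqxx; apply: contraTneq us => ->; rewrite mem_head.
Qed.

(** A vertex with two neighbours gives a path on three vertices, which [path_long_cycle] closes with
    the trivial bound [L = 0]. This rules out the default value 0 of the circumference. *)
Lemma biconnected_cycle : biconnected e -> 2 < #|V| -> exists2 r, ucycleb e r & 2 < size r.
Proof.
move=> C2 V3.
have nbr v u z : u != v -> z != v -> u != z -> exists2 w, w != v & e u w.
  move=> uv zv uz; case/connectP: (C2 v u z uv zv) => [[|w p] /=].
    by move=> _ E; rewrite E eqxx in uz.
  by case/andP => /and3P [_ wv uw] _ _; exists w.
have [a [b [d [ab ad bd]]]] : exists a b d : V, [/\ a != b, a != d & b != d].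
  move: V3 (enum_uniq V); rewrite cardE; case: (enum V) => [|a [|b [|d l]]] //= _.
  by rewrite !inE !negb_or => /and3P [/and3P [ab ad _] /andP [bd _] _]; exists a, b, d.
have [w wa dw] : exists2 w, w != a & e b w by apply: (nbr a b d); rewrite // eq_sym.
have bw : b != w by apply: contraTneq dw => ->; rewrite e_irr.
have [z zw bz] : exists2 z, z != w & e b z by apply: (nbr w b a) => //; rewrite eq_sym.
have bz' : b != z by apply: contraTneq bz => ->; rewrite e_irr.
have pw : path e w [:: b; z] by rewrite /= e_sym dw bz.
have uw : uniq [:: w; b; z] by rewrite /= !inE negb_or eq_sym bw eq_sym zw bz'.
have [r /andP [r2 ur] _] := path_long_cycle e_sym e_irr C2 pw uw isT (leq0n _) (leq0n _).
by exists r.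
Qed.

(* The core for c / 2 is empty or a clique; in the latter case, with h vertices,
   it is also the core for j = c + 1 - h, by [dense_sets_joined] applied to
   these two cores. *)
Lemma core_size c k :
  biconnected e -> saturated e c -> no_cycle_above e c -> 2 < c < #|V| ->
  (forall x, k <= degree_in setT x) ->
  exists j, (k <= j <= c %/ 2 \/ j = c %/ 2) /\ #|core j| <= c + 1 - j.
Proof.
move=> C2 sat hc /andP [c3 cV] dk; set t := c %/ 2; pose H := core t.
have t1 : 0 < t by rewrite /t; lia.
have ct : c < t.+1 + t.+1 by rewrite /t; lia.
case: (set_0Vmem H) => [H0|[x0 x0H]].
  by exists t; split; [right|rewrite -/H H0 cards0].
have clH : {in H &, forall x y, x != y -> e x y}.
  by move=> x y; apply: (dense_sets_joined C2 sat hc (a := t.+1) (b := t.+1)) => // z; exact: core_degree.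
have dH x : x \in H -> degree_in H x = #|H|.-1.
  move=> xH; rewrite (cardsD1 x) xH /=; apply: eq_card => y; rewrite !inE.
  case: eqVneq => [->|yx]; first by rewrite e_irr andbF.
  by case: (boolP (y \in H)) => //= yH; rewrite clH // eq_sym.
have hH : t.+1 < #|H| by have := core_degree x0H; rewrite -/H dH //; lia.
have hc' : #|H| <= c.
  have [|r ur rH] := clique_cycle _ clH; first by lia.
  by rewrite -rH; apply: hc => //; rewrite rH; lia.
(* With this value [j.+1] and [#|H|.-1], the degrees guaranteed inside [core j] and [H], add up to
   [c + 1]. *)
pose j := c + 1 - #|H|.
have jt : j <= t by rewrite /j; lia.
have joined := dense_sets_joined C2 sat hc (A := core j) (B := H) (a := j.+1) (b := #|H|.-1)
  (@core_degree j).
have HE : core j = H.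
  apply/eqP; rewrite eqEsubset (core_antimono jt) andbT; apply/subsetP => x xj.
  apply/negPn/negP => xH.
  have xall y : y \in H -> e x y.
    move=> yH; apply: joined => //; try by rewrite /j; lia.
    - by move=> z /dH ->.
    - by apply: contraNneq xH => ->.
  (* As [x] is adjacent to all of [H], every vertex of [x |: H] has degree above [t] in it, so [x]
     belongs to the core by maximality. *)
  case/negP: xH; apply: (subsetP (core_max _)) (setU11 x H) => z.
  have sub : H \subset x |: H by apply: subsetUr.
  rewrite !inE => /orP [/eqP->|/core_degree zt]; last exact: leq_trans zt (degree_in_subset _ sub).
  apply: leq_trans (degree_in_subset _ sub); apply: leq_trans (ltnW hH) _.
  by apply: subset_leq_card; apply/subsetP => y yH; rewrite inE yH xall.
exists j; split; last by rewrite HE /j; lia.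
(* If [j < k], every degree exceeds [j] and [core j] is the whole vertex set; but it equals [H],
   which has at most [c < #|V|] vertices. *)
left; apply/andP; split=> //; rewrite leqNgt; apply/negP => jk.
have : [set: V] \subset core j by apply: core_max => x _; apply: leq_trans jk (dk x).
by rewrite HE => /subset_leq_card; rewrite cardsT; lia.
Qed.
End Core.

(** * Counting embeddings *)

Section NestedInjections.
Variables (T V : finType) (v0 : V) (A : T -> {set V}).

(** Injections of the partial domain [l] are encoded as total functions; the fixed value [v0] off
    [l] makes the encoding unique, so that points can be added one at a time. *)
Definition injections_on (l : seq T) : {set {ffun T -> V}} :=
  [set f : {ffun T -> V} | [&& all (fun x => f x \in A x) l, uniq (map f l)
             & [forall x, (x \notin l) ==> (f x == v0)]]].

(** All [size l] values already taken lie in [A x], by nestedness, so the number of choices left for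
    [x] is the same for every injection. *)
Lemma card_injections_on_cons x l :
  x \notin l -> (forall y, y \in l -> A y \subset A x) ->
  #|injections_on (x :: l)| = #|injections_on l| * (#|A x| - size l).
Proof.
move=> xl Al.
pose upd (f : {ffun T -> V}) u := [ffun y => if y == x then u else f y].
have updx f u : upd f u x = u by rewrite ffunE eqxx.
have updl f u y : y \in l -> upd f u y = f y.
  by move=> yl; rewrite ffunE; case: eqP => // E; rewrite -E yl in xl.
have upd_all f u : all (fun y => upd f u y \in A y) l = all (fun y => f y \in A y) l.
  by apply: eq_in_all => y yl; rewrite updl.
have upd_map f u : map (upd f u) l = map f l by apply/eq_in_map => y; apply: updl.
rewrite -sum1_card (partition_big (upd^~ v0) [in injections_on l]) /=; last first.
  move=> g; rewrite !inE /= => /and3P [/andP [_ gA] /andP [_ gu] /forallP g0].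
  rewrite upd_all gA upd_map gu /=; apply/forallP => y; apply/implyP => yl.
  rewrite ffunE; case: (eqVneq y x) => // yx; have := g0 y.
  by rewrite inE negb_or yx yl.
rewrite -sum_nat_const; apply: eq_bigr => f fX.
have -> : #|A x| - size l = #|A x :\: [set y in map f l]|.
  move: fX; rewrite inE => /and3P [fA fu _].
  rewrite cardsD; congr (_ - _); rewrite (setIidPr _).
    by rewrite cardsE (card_uniqP fu) size_map.
  apply/subsetP => u; rewrite inE => /mapP [y yl ->].
  by apply: (subsetP (Al y yl)); apply: (allP fA).
rewrite sum1_card -[RHS](card_imset _ (f := upd f)); last first.
  by move=> u w E; rewrite -(updx f u) E updx.
apply: eq_card => g; apply/idP/imsetP.
  rewrite unfold_in inE /= => /andP [/and3P [/andP [gx gA] /andP [gx' gu] /forallP g0] /eqP gf].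
  have gE : g = upd f (g x).
    by apply/ffunP => y; rewrite -gf !ffunE; case: eqP => // ->.
  exists (g x) => //; rewrite !inE gx andbT.
  by rewrite -gf upd_map.
case=> u; rewrite !inE => /andP [uf uA] ->.
move: fX; rewrite inE => /and3P [fA fu /forallP f0].
rewrite unfold_in inE /= updx uA upd_all fA upd_map uf fu /=; apply/andP; split.
  apply/forallP => y; apply/implyP; rewrite inE negb_or => /andP [yx yl].
  by rewrite ffunE (negPf yx); apply: (implyP (f0 y)).
apply/eqP/ffunP => y; rewrite !ffunE; case: eqP => // ->.
by apply/esym/eqP; apply: (implyP (f0 x)).
Qed.

Lemma card_injections_on_cat (B : {set V}) l l0 :
  uniq (l ++ l0) -> (forall x, x \in l -> A x = B) ->
  (forall x, x \in l0 -> A x \subset B) ->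
  #|injections_on (l ++ l0)| = #|injections_on l0| * (#|B| - size l0) ^_ (size l).
Proof.
elim: l => [|x l IHl] /=; first by rewrite ffactn0 muln1.
move=> /andP [xl ul] lB l0B.
have lB' y : y \in l -> A y = B by move=> yl; apply: lB; rewrite inE yl orbT.
rewrite card_injections_on_cons //; last first.
  move=> y; rewrite mem_cat (lB x) ?mem_head // => /orP [/lB' -> //|]; exact: l0B.
by rewrite IHl // -mulnA ffactnSr size_cat (lB x) ?mem_head // addnC subnDA.
Qed.

Lemma card_injections_on_nil : #|injections_on [::]| = 1.
Proof.
apply/eqP/cards1P; exists [ffun=> v0]; apply/setP => f; rewrite !inE /=.
apply/forallP/eqP => [h|-> x]; last by rewrite ffunE.
by apply/ffunP => x; rewrite ffunE; apply/eqP; apply: h.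
Qed.

End NestedInjections.

Definition confined_injections (T V : finType) (A : T -> {set V}) : {set {ffun T -> V}} :=
  [set f : {ffun T -> V} | injectiveb f && [forall x, f x \in A x]].

Lemma confined_injectionsE (T V : finType) (v0 : V) (A : T -> {set V}) l :
  uniq l -> (forall x, x \in l) -> confined_injections A = injections_on v0 A l.
Proof.
move=> ul hl; apply/setP => f; rewrite !inE.
have -> : [forall x, (x \notin l) ==> (f x == v0)].
  by apply/forallP => x; rewrite hl.
rewrite andbT andbC; congr (_ && _).
  apply/forallP/allP => [h x _|h x]; [exact: h|exact: h].
apply/injectiveP/idP => [inj|um]; first by rewrite map_inj_uniq.
move=> x y; rewrite -{2}(nth_index x (hl x)) -{2}(nth_index x (hl y)) => E.
have [ix iy] : index x l < size l /\ index y l < size l by rewrite !index_mem.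
apply/eqP; rewrite nth_uniq // -(nth_uniq (f x) _ _ um) ?size_map //.
by rewrite !(nth_map x) // !nth_index // E.
Qed.

Lemma card_two_level_injections (T V : finType) (Q : {set T}) (A B : {set V}) :
  A \subset B ->
  #|confined_injections (fun x => if x \in Q then A else B)| =
  #|A| ^_ #|Q| * (#|B| - #|Q|) ^_ (#|T| - #|Q|).
Proof.
move=> AB; case: (pickP [pred v : V | true]) => [v0 _|noV]; last first.
  have V0 (C : {set V}) : #|C| = 0 by apply: eq_card0 => v; have := noV v.
  rewrite !V0 sub0n; case: (pickP [pred x : T | true]) => [x0 _|noT].
    rewrite eq_card0 => [|f]; last by have := noV (f x0).
    have T0 : 0 < #|T| by apply/card_gt0P; exists x0.
    case: (posnP #|Q|) => [->|Q0]; last by rewrite (ffact_small Q0).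
    by rewrite subn0 (ffact_small T0) muln0.
  have T0 : #|T| = 0 by apply: eq_card0 => x; have := noT x.
  have Q0 : #|Q| = 0 by apply: eq_card0 => x; have := noT x.
  rewrite T0 Q0; have x0 x : T -> x = true by move=> y; have := noT y.
  apply/eqP/cards1P.
  have Tv (x : T) : V by have := noT x.
  exists [ffun x => Tv x]; apply/setP => f; rewrite !inE.
  have -> : f == [ffun x => Tv x] by apply/eqP/ffunP => x; have := noT x.
  by apply/andP; split; [apply/injectiveP => x|apply/forallP => x]; have := noT x.
have cE (C : {set T}) : size (enum C) = #|C| by rewrite cardE.
have uQ : uniq (enum (~: Q) ++ enum Q).
  rewrite cat_uniq !enum_uniq andbT; apply/hasPn => x; rewrite /= !mem_enum inE.
  by move=> ->.
rewrite (confined_injectionsE v0 _ uQ); last first.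
  by move=> x; rewrite mem_cat !mem_enum inE orNb.
rewrite (card_injections_on_cat v0 uQ (B := B)); last first.
- by move=> x; rewrite mem_enum => ->.
- by move=> x; rewrite mem_enum inE => /negPf ->.
have uQ' : uniq (enum Q ++ [::]) by rewrite cats0 enum_uniq.
rewrite -[X in injections_on _ _ X]cats0 (card_injections_on_cat v0 uQ' (B := A)) //; last first.
  by move=> x; rewrite mem_enum => ->.
by rewrite card_injections_on_nil !cE mul1n subn0 (cardsCs (~: Q)) setCK.
Qed.

(** Made for embeddings that send [h] to a deleted vertex [v], with [A] the neighbourhood of [v] and
    [Q] the other classes. The range [v |: A] in place of [A] makes the three ranges nested and
    changes nothing, since [v] is taken by [h]. *)
Lemma card_three_level_injections (T V : finType) (h : T) (v : V) (Q : {set T}) (A B : {set V}) :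
  h \notin Q -> v \notin A -> v \in B -> A \subset B ->
  #|confined_injections (fun x => if x == h then [set v] else if x \in Q then v |: A else B)| =
  #|A| ^_ #|Q| * (#|B|.-1 - #|Q|) ^_ (#|T| - #|Q|).-1.
Proof.
move=> hQ vA vB AB.
have AB' : v |: A \subset B by rewrite subUset sub1set vB.
have cE (C : {set T}) : size (enum C) = #|C| by rewrite cardE.
set D := ~: (h |: Q).
have u1 : uniq (enum Q ++ [:: h]) by rewrite cat_uniq enum_uniq /= orbF mem_enum hQ.
have u2 : uniq (enum D ++ (enum Q ++ [:: h])).
  rewrite cat_uniq u1 enum_uniq andbT; apply/hasPn => x.
  by rewrite /= mem_cat !mem_enum !inE orbC => ->.
rewrite (confined_injectionsE v _ u2); last first.
  by move=> x; rewrite !mem_cat !mem_enum !inE; case: (x == h); case: (x \in Q).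
rewrite (card_injections_on_cat v u2 (B := B)); last first.
- move=> x; rewrite mem_cat mem_enum inE; case: eqP => [-> _|_]; first by rewrite sub1set.
  by rewrite orbF => ->.
- by move=> x; rewrite mem_enum !inE negb_or => /andP [/negPf -> /negPf ->].
rewrite (card_injections_on_cat v u1 (B := v |: A)); last first.
- by move=> x; rewrite inE => ->; rewrite sub1set setU11.
- move=> x; rewrite mem_enum => xQ; rewrite xQ; case: eqP => // E.
  by rewrite -E xQ in hQ.
have u0 : uniq ([:: h] ++ [::]) by [].
rewrite -[X in injections_on _ _ X]cats0 (card_injections_on_cat v u0 (B := [set v])) //; last first.
  by move=> x; rewrite inE => ->.
rewrite card_injections_on_nil !size_cat !cE cards1 /= mul1n subn0 ffactn1 mul1n cardsU1 vA add1n subn1 /=.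
have -> : #|D| = (#|T| - #|Q|).-1 by rewrite /D (cardsCs (~: _)) setCK cardsU1 hQ; lia.
by congr (_ * _ ^_ _); lia.
Qed.

Lemma leq_ffact k m n : m <= n -> m ^_ k <= n ^_ k.
Proof.
by move=> mn; elim: k => // k IHk; rewrite !ffactnSr leq_mul // leq_sub2r.
Qed.

Lemma ffactD n k l : n ^_ (k + l) = n ^_ k * (n - k) ^_ l.
Proof.
elim: l => [|l IHl]; first by rewrite addn0 muln1.
by rewrite addnS !ffactnSr IHl -mulnA subnDA.
Qed.

(** * Embeddings of a complete multipartite graph *)

Section Multipartite.
Variables (T I : finType) (p : T -> I).

Definition part_size i := #|[set x | p x == i]|.

Definition outside i := #|T| - part_size i.

Lemma part_size_leq i : part_size i <= #|T|.
Proof. exact: max_card. Qed.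

Lemma card_outside i : #|[set x | p x != i]| = outside i.
Proof.
rewrite /outside /part_size (cardsCs [set x | p x != i]); congr (_ - _).
by apply: eq_card => x; rewrite !inE negbK.
Qed.

Lemma sum_part_size : \sum_i part_size i = #|T|.
Proof.
rewrite -sum1_card (partition_big p predT) //=; apply: eq_bigr => i _.
by rewrite /part_size -sum1_card; apply: eq_bigl => x; rewrite inE.
Qed.

(* The number of embeddings of the complete multipartite graph with classes
   [part_size i] into K_j v (K_(m - 2 j) + complement of K_(n - m + j)), which
   is the extremal graph for m = c + 1: an embedding either avoids the
   independent set, or exactly one class meets it and the rest lies in K_j. *)
Definition extremal_count n m j :=
  (m - j) ^_ #|T| +
  \sum_i j ^_ (outside i) * ((n - outside i) ^_ (part_size i) - (m - j - outside i) ^_ (part_size i)).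

Definition embeddings (V : finType) (e : rel V) (S : {set V}) : {set {ffun T -> V}} :=
  [set f : {ffun T -> V} | [&& injectiveb f, [forall x, f x \in S] &
    [forall x, forall y, (p x != p y) ==> e (f x) (f y)]]].

(* The classes not containing h are mapped into the neighbourhood of v. *)
Lemma embeddings_vertex_leq (V : finType) (e : rel V) (S : {set V}) v h j :
  irreflexive e -> v \in S -> degree_in e S v <= j ->
  #|[set f in embeddings e S | f h == v]| <=
  j ^_ (outside (p h)) * (#|S|.-1 - outside (p h)) ^_ (part_size (p h)).-1.
Proof.
move=> e_irr vS dj.
set Q := [set x | p x != p h]; set N := [set y in S | e v y].
have hQ : h \notin Q by rewrite inE eqxx.
have vN : v \notin N by rewrite inE e_irr andbF.
have NS : N \subset S by apply/subsetP => y; rewrite inE => /andP [].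
have := card_three_level_injections hQ vN vS NS.
have cQ : #|Q| = outside (p h) := card_outside (p h).
rewrite !cQ {3}/outside subKn ?part_size_leq // => E.
apply: leq_trans (leq_mul (leq_ffact _ dj) (leqnn _)).
rewrite /degree_in -/N -E; apply: subset_leq_card; apply/subsetP => f.
rewrite !inE => /andP [/and3P [-> /forallP fS /forallP fe] /eqP fh] /=.
apply/forallP => x; case: eqP => [->|_]; first by rewrite fh set11.
case: (boolP (x \in Q)) => // xQ; rewrite !inE fS /=.
by have /forallP /(_ x) /implyP := fe h; rewrite fh => ->; rewrite ?orbT //; rewrite inE eq_sym in xQ.
Qed.

(** An embedding lost with [v] sends some [h] to [v]. The bound for [h] depends only on its class,
    which gives the factor [part_size i]. *)
Lemma embeddings_delete (V : finType) (e : rel V) (S : {set V}) v j :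
  irreflexive e -> v \in S -> degree_in e S v <= j ->
  #|embeddings e S| <= #|embeddings e (S :\ v)| +
    \sum_i part_size i * (j ^_ (outside i) * (#|S|.-1 - outside i) ^_ (part_size i).-1).
Proof.
move=> e_irr vS dj.
apply: leq_trans (_ : #|embeddings e (S :\ v)| + \sum_h #|[set f in embeddings e S | f h == v]| <= _).
  apply: leq_trans (_ : #|embeddings e (S :\ v) :|: \bigcup_h [set f in embeddings e S | f h == v]| <= _).
    apply: subset_leq_card; apply/subsetP => f fS; rewrite inE.
    case: (boolP [exists h, f h == v]) => [/existsP [h fh]|none].
      by apply/orP; right; apply/bigcupP; exists h => //; rewrite inE fS.
    apply/orP; left; move: fS; rewrite !inE => /and3P [-> /forallP fS ->].
    rewrite andbT; apply/forallP => x; rewrite !inE fS andbT.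
    by apply: contra none => fx; apply/existsP; exists x.
  apply: leq_trans (leq_card_setU _ _) _; rewrite leq_add2l.
  elim/big_rec2: _ => [|h a B _ IH]; first by rewrite cards0.
  by apply: leq_trans (leq_card_setU _ _) _; rewrite leq_add2l.
rewrite leq_add2l (partition_big p predT) //=; apply: leq_sum => i _.
rewrite /part_size -sum_nat_const big_mkcond [leqRHS]big_mkcond /=.
apply: leq_sum => h _; rewrite inE; case: eqP => // <-.
exact: embeddings_vertex_leq.
Qed.

Lemma ffactS_sub n k : n.+1 ^_ k = n ^_ k + k * n ^_ k.-1.
Proof.
case: k => [|k]; first by rewrite !ffactn0.
rewrite ffactSS ffactnSr /=; case: (leqP k n) => kn; last by rewrite ffact_small ?muln0.
by rewrite [_ * (n - k)]mulnC -mulnDl; congr (_ * _); lia.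
Qed.

(** This is the effect of one more independent vertex. The order [n] enters only through falling
    factorials of exponent [part_size i], whose first difference, by [ffactS_sub], matches the loss
    allowed in [embeddings_delete]. *)
Lemma extremal_count_step n m j : j <= m - j -> m - j <= n ->
  extremal_count n m j +
    \sum_i part_size i * (j ^_ (outside i) * (n - outside i) ^_ (part_size i).-1)
  <= extremal_count n.+1 m j.
Proof.
move=> jm mn; rewrite /extremal_count -addnA leq_add2l -big_split /=.
apply: leq_sum => i _; set q := outside i; set r := part_size i.
case: (leqP q j) => qj; last by rewrite ffact_small // !mul0n muln0.
rewrite mulnCA -mulnDr leq_mul2l; apply/orP; right.
rewrite subSn; last by lia.
rewrite ffactS_sub.
have : (m - j - q) ^_ r <= (n - q) ^_ r by apply: leq_ffact; lia.
lia.
Qed.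

Lemma card_embeddings_leq (V : finType) (e : rel V) (S : {set V}) :
  #|embeddings e S| <= #|S| ^_ #|T|.
Proof.
have := card_two_level_injections (set0 : {set T}) (subxx S).
rewrite cards0 subn0 ffactn0 mul1n !subn0 => <-.
apply: subset_leq_card; apply/subsetP => f; rewrite !inE => /and3P [-> /forallP fS _] /=.
by apply/forallP => x; rewrite inE.
Qed.

(** Vertices are deleted until [m - j] remain, the number of vertices outside the independent part
    of the extremal graph, even if the core is smaller. At that point all injections are counted,
    and these make up the first term of [extremal_count]. *)
Lemma embeddings_leq_extremal (V : finType) (e : rel V) m j :
  symmetric e -> irreflexive e -> j <= m - j -> m <= #|V| -> #|core e j| <= m - j ->
  #|embeddings e setT| <= extremal_count #|V| m j.
Proof.
move=> e_sym e_irr jm mV cj.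
suff main k : forall S : {set V}, #|S| = m - j + k -> core e j \subset S ->
    #|embeddings e S| <= extremal_count (m - j + k) m j.
  have := main (#|V| - (m - j)) setT; rewrite cardsT subnKC; last by lia.
  by apply => //; apply: subsetT.
elim: k => [|k IHk] S Sk cS.
  by apply: leq_trans (card_embeddings_leq _ _) _; rewrite Sk addn0 leq_addr.
have pS : core e j \proper S by rewrite properEcard cS; lia.
have [v vS vj] := low_degree_vertex pS.
have Sv : #|S :\ v| = m - j + k by have := cardsD1 v S; rewrite vS; lia.
apply: leq_trans (embeddings_delete e_irr vS vj) _.
have -> : #|S|.-1 = m - j + k by lia.
rewrite addnS; apply: leq_trans (extremal_count_step _ _) => //; last by lia.
rewrite leq_add2r; apply: IHk => //; apply/subsetP => x xc.
rewrite !inE (subsetP cS) // andbT; apply: contraTneq vj => xv.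
have := core_degree xc; rewrite xv -ltnNge => h; apply: leq_trans h _.
exact: degree_in_subset.
Qed.

(** [E0] collects the embeddings that avoid [J], and [E i] those that meet [J] while every class but
    [i] goes into [K]. The families are disjoint, since a point sent to [J] reveals its class. A
    lower bound suffices, as the extremal graph stands on the larger side of the theorem. *)
Lemma extremal_count_leq (V : finType) (e : rel V) (K J : {set V}) :
  [disjoint K & J] ->
  (forall x y, x != y -> (x \in K) || (x \notin J) && (y \notin J) -> e x y && e y x) ->
  extremal_count #|V| (#|K| + #|~: J|) #|K| <= #|embeddings e setT|.
Proof.
move=> KJ he; have KJ' : K \subset ~: J by rewrite -disjoints_subset.
pose E0 := [set f : {ffun T -> V} | injectiveb f && [forall x, f x \in ~: J]].
pose E i := [set f : {ffun T -> V} | [&& injectiveb f, [forall x, (p x != i) ==> (f x \in K)]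
   & [exists x, f x \in J]]].
have cE0 : #|E0| = (#|K| + #|~: J| - #|K|) ^_ #|T|.
  have := card_two_level_injections (set0 : {set T}) (subxx (~: J)).
  rewrite cards0 !subn0 ffactn0 mul1n addKn => <-.
  apply: eq_card => f; rewrite !inE; congr (_ && _); apply: eq_forallb => x.
  by rewrite in_set0.
have cE i : #|E i| = #|K| ^_ (outside i) * ((#|V| - outside i) ^_ (part_size i)
    - (#|K| + #|~: J| - #|K| - outside i) ^_ (part_size i)).
  pose Q := [set x | p x != i].
  have h1 := card_two_level_injections Q (subsetT K).
  have h2 := card_two_level_injections Q KJ'.
  rewrite card_outside {2}/outside subKn ?part_size_leq // in h1.
  rewrite card_outside {2}/outside subKn ?part_size_leq // in h2.
  (* [E i] is counted as a difference: class [i] anywhere, minus class [i] outside [J], the other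
     classes being in [K] both times. *)
  rewrite addKn mulnBr -cardsT -h1 -h2 -cardsDS.
    apply: eq_card => f; rewrite !inE.
    case: (injectiveb f) => //=; rewrite ?andbF //.
    have -> : [forall x, (p x != i) ==> (f x \in K)] = [forall x, f x \in (if x \in Q then K else setT)].
      by apply: eq_forallb => x; rewrite inE; case: (p x == i); rewrite /= ?inE.
    case: (boolP [forall x, f x \in (if x \in Q then K else setT)]) => [/forallP fK|]; rewrite ?andbF ?andbT //=.
    rewrite negb_forall; apply: eq_existsb => x; have := fK x.
    case: (x \in Q); rewrite ?inE ?negbK // => xK.
    by rewrite xK; apply/negbTE; have := subsetP KJ' _ xK; rewrite inE.
  apply/subsetP => f; rewrite !inE => /andP [-> /forallP h] /=.
  apply/forallP => x; have := h x; case: (x \in Q) => //; by rewrite inE.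
rewrite /extremal_count -cE0 (eq_bigr (fun i => #|E i|)) => [|i _]; last by rewrite cE.
have dE i i' : i != i' -> [disjoint E i & E i'].
  move=> ii'; apply/pred0P => f /=; apply/negP; rewrite !inE.
  move=> /andP [/and3P [_ /forallP h /existsP [x xJ]] /and3P [_ /forallP h' _]].
  have xK : f x \notin K by apply/negP => xK; have := subsetP KJ' _ xK; rewrite inE xJ.
  have := h x; have := h' x; rewrite (negPf xK) !implybF !negbK => /eqP E1 /eqP E2.
  by rewrite -E1 -E2 eqxx in ii'.
have cU : \sum_i #|E i| = #|\bigcup_i E i|.
  rewrite -[RHS]sum1_card partition_disjoint_bigcup //.
  by apply: eq_bigr => i _; rewrite sum1_card.
have d0 : [disjoint E0 & \bigcup_i E i].
  apply/pred0P => f /=; apply/negP => /andP [f0 /bigcupP [i _]]; rewrite inE => /and3P [_ _ /existsP [x xJ]].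
  by move: f0; rewrite inE => /andP [_ /forallP /(_ x)]; rewrite inE xJ.
rewrite cU -cardsUI (_ : _ :&: _ = set0) ?cards0 ?addn0; last first.
  by apply/eqP; rewrite setI_eq0.
apply: subset_leq_card; apply/subsetP => f; rewrite inE => /orP [|/bigcupP [i _]]; rewrite !inE.
- move=> /andP [inj /forallP fJ]; rewrite inj /=; apply/andP; split; first by apply/forallP => x; rewrite inE.
  apply/forallP => x; apply/forallP => y; apply/implyP => pxy.
  have fxy : f x != f y.
    by rewrite (inj_eq (injectiveP _ inj)); apply: contraNneq pxy => ->.
  have := fJ x; have := fJ y; rewrite !inE => fyJ fxJ.
  by have := he _ _ fxy; rewrite fyJ fxJ orbT => /(_ isT) /andP [].
- move=> /and3P [inj /forallP fK _]; rewrite inj /=; apply/andP; split; first by apply/forallP => x; rewrite inE.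
  apply/forallP => x; apply/forallP => y; apply/implyP => pxy.
  have fxy : f x != f y.
    by rewrite (inj_eq (injectiveP _ inj)); apply: contraNneq pxy => ->.
  case: (boolP (p x == i)) => [/eqP px|px].
    have yK : f y \in K by apply: (implyP (fK y)); rewrite -px eq_sym.
    by rewrite eq_sym in fxy; have := he _ _ fxy; rewrite yK => /(_ isT) /andP [].
  have xK : f x \in K by apply: (implyP (fK x)).
  by have := he _ _ fxy; rewrite xK => /(_ isT) /andP [].
Qed.

(** * Convexity of the extremal count in [j] *)

Lemma ffact_second_difference n k :
  n.+2 ^_ k + n ^_ k = 2 * n.+1 ^_ k + k * k.-1 * n ^_ k.-2.
Proof. by rewrite (ffactS_sub n.+1) (ffactS_sub n k.-1) (ffactS_sub n k) ; lia. Qed.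

Lemma ffact_convex n k : 2 * n.+1 ^_ k <= n ^_ k + n.+2 ^_ k.
Proof. by have := ffact_second_difference n k; lia. Qed.

(** With [a1 = a0 + u], [a2 = a0 + 2 * u + w] and [b2 = b1 + z], the right side exceeds the left by
    [a0 * (b0 + b2 + d - 2 * b1) + 2 * u * z + w * b2]. So the defect [d] is charged with the
    smallest factor [a0] only. *)
Lemma convex_concave_product (a0 a1 a2 b0 b1 b2 d : nat) :
  a0 <= a1 -> 2 * a1 <= a0 + a2 -> b1 <= b2 -> 2 * b1 <= b0 + b2 + d ->
  2 * (a1 * b1) <= a0 * b0 + a2 * b2 + a0 * d.
Proof.
move=> h1 h2 h3 h4.
have [u Eu] : exists u, a1 = a0 + u by exists (a1 - a0); lia.
have [w Ew] : exists w, a2 = a0 + 2 * u + w by exists (a2 - a0 - 2 * u); lia.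
have [z Ez] : exists z, b2 = b1 + z by exists (b2 - b1); lia.
subst a1 a2 b2.
have : a0 * (2 * b1) <= a0 * (b0 + (b1 + z) + d) by rewrite leq_mul2l h4 orbT.
nia.
Qed.

(* Each summand is the product of an increasing convex and an increasing
   concave function of j; the concavity loses at most the second difference
   of the leading falling factorial. *)
Lemma extremal_count_convex n m i :
  2 * i.+2 < m -> m <= n ->
  2 * extremal_count n m i.+1 <= extremal_count n m i + extremal_count n m i.+2.
Proof.
move=> im mn; have [N mE] : exists N, m = N + i.+2 by exists (m - i.+2); lia.
have [E0 E1 E2] : [/\ m - i = N.+2, m - i.+1 = N.+1 & m - i.+2 = N] by split; lia.
rewrite /extremal_count E0 E1 E2.
pose D k := part_size k * (part_size k).-1 * N ^_ (#|T|.-2).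
have term k : 2 * (i.+1 ^_ outside k * ((n - outside k) ^_ part_size k - (N.+1 - outside k) ^_ part_size k))
  <= (i ^_ outside k * ((n - outside k) ^_ part_size k - (N.+2 - outside k) ^_ part_size k)
   + i.+2 ^_ outside k * ((n - outside k) ^_ part_size k - (N - outside k) ^_ part_size k)) + D k.
  set q := outside k; set r := part_size k.
  case: (leqP q N) => qN; last by rewrite !(@ffact_small _ q) ?mul0n ?muln0 //; lia.
  pose x := N - q; have [x1 x2] : N.+1 - q = x.+1 /\ N.+2 - q = x.+2 by rewrite /x; lia.
  rewrite x1 x2 -/x.
  have xn : x.+2 <= n - q by rewrite /x; lia.
  have c2 : x.+2 ^_ r <= (n - q) ^_ r by apply: leq_ffact.
  have c1 : x.+1 ^_ r <= x.+2 ^_ r by apply: leq_ffact.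
  have c0 : x ^_ r <= x.+1 ^_ r by apply: leq_ffact.
  have sd := ffact_second_difference x r.
  have h3 : (n - q) ^_ r - x.+1 ^_ r <= (n - q) ^_ r - x ^_ r by rewrite leq_sub2l.
  have h4 : 2 * ((n - q) ^_ r - x.+1 ^_ r) <=
      (n - q) ^_ r - x.+2 ^_ r + ((n - q) ^_ r - x ^_ r) + r * r.-1 * x ^_ r.-2.
    move: sd c0 c1 c2; move: (_ ^_ r.-2) (x ^_ r) (x.+1 ^_ r) (x.+2 ^_ r) (_ ^_ r) => y0 y1 y2 y3 y4.
    by move: (_ * y0); lia.
  apply: leq_trans (convex_concave_product (leq_ffact q (leqnSn i)) (ffact_convex i q) h3 h4) _.
  rewrite leq_add2l /D mulnCA leq_mul2l -/r; case: (ltnP 1 r) => r2; last by case: (r) r2 => [|[]].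
  apply/orP; right; have -> : #|T|.-2 = q + r.-2.
    by have := part_size_leq k; rewrite /q /outside -/r; lia.
  (* From [2 * i.+2 < m] follows [i <= N], so [i ^_ q] is absorbed into a falling factorial of
     [N]. *)
  rewrite ffactD leq_mul2r; apply/orP; right; apply: leq_ffact; lia.
have sd := ffact_second_difference N #|T|.
(* The right side is the second difference of the leading term. It covers all defects because the
   class sizes add up to [#|T|] and none exceeds [#|T|]. *)
have total : \sum_k D k <= #|T| * #|T|.-1 * N ^_ (#|T|.-2).
  rewrite -big_distrl leq_mul2r /=; apply/orP; right.
  rewrite -{1}sum_part_size big_distrl /=; apply: leq_sum => k _.
  by rewrite leq_mul2l; apply/orP; right; rewrite -!subn1 leq_sub2r ?part_size_leq.
pose X k := i.+1 ^_ outside k * ((n - outside k) ^_ part_size k - (N.+1 - outside k) ^_ part_size k).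
pose Y k := i ^_ outside k * ((n - outside k) ^_ part_size k - (N.+2 - outside k) ^_ part_size k).
pose Z k := i.+2 ^_ outside k * ((n - outside k) ^_ part_size k - (N - outside k) ^_ part_size k).
have ht : 2 * \sum_k X k <= \sum_k Y k + \sum_k Z k + \sum_k D k.
  rewrite -!big_split big_distrr /=; apply: leq_sum => k _; exact: term.
rewrite -/(\sum_k X k) -/(\sum_k Y k) -/(\sum_k Z k).
move: sd total ht; move: (\sum_k D k) (\sum_k X k) (\sum_k Y k) (\sum_k Z k) (_ ^_ _.-2) => d x y z w.
move: (N ^_ _) (N.+1 ^_ _) (N.+2 ^_ _) (_ * w) => f0 f1 f2 u.
lia.
Qed.

End Multipartite.

(** If [f j] exceeds [f k], then [f] rises at some step between them, and by convexity it keeps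
    rising up to [t]. *)
Lemma convex_leq_maxn (f : nat -> nat) k t j :
  (forall i, i.+2 <= t -> 2 * f i.+1 <= f i + f i.+2) ->
  k <= j <= t -> f j <= maxn (f k) (f t).
Proof.
move=> cvx /andP [kj jt]; rewrite leq_max; case: (leqP (f j) (f k)) => //= fkj.
have [i [ki ij fi]] : exists i, [/\ k <= i, i < j & f i < f i.+1].
  elim: j kj jt fkj => [|j IHj]; rewrite leq_eqVlt => /orP [/eqP ->|//]; rewrite ?ltnn // => kj jt fkj.
  case: (ltnP (f j) (f j.+1)) => fj; first by exists j.
  have [|i [ki ij fi]] := IHj kj (ltnW jt); first exact: leq_trans fkj fj.
  by exists i; split=> //; apply: ltnW.
have inc d : i + d < t -> f (i + d) < f (i + d).+1.
  elim: d => [|d IHd] idt; first by rewrite addn0.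
  rewrite addnS in idt *; have := cvx (i + d) idt; have := IHd (ltnW idt); lia.
have mono d : j + d <= t -> f j <= f (j + d).
  elim: d => [|d IHd] jdt; first by rewrite addn0.
  apply: leq_trans (IHd _) _; first by lia.
  have := inc (j + d - i); rewrite subnKC; last by lia.
  by rewrite addnS in jdt *; move=> /(_ jdt)/ltnW.
by have := mono (t - j); rewrite subnKC //; apply.
Qed.

(** * Copies and embeddings *)

Section Copies.
Variables H G : sgraph.

Definition automorphisms : {set {ffun H -> H}} :=
  [set g : {ffun H -> H} | injectiveb g && [forall x, forall y, adj x y == adj (g x) (g y)]].

Definition homomorphic_injections : {set {ffun H -> G}} :=
  [set f : {ffun H -> G} | injectiveb f && [forall x, forall y, adj x y ==> adj (f x) (f y)]].

Definition image_subgraph (f : {ffun H -> G}) : {set G} * {set {set G}} :=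
  ([set f x | x : H], [set [set f x; f y] | x in H, y in adj x]).

Lemma set2_inj (T : finType) (a b x y : T) :
  [set a; b] = [set x; y] -> a = x /\ b = y \/ a = y /\ b = x.
Proof.
move=> E.
have ha : a = x \/ a = y by apply/set2P; rewrite -E set21.
have hb : b = x \/ b = y by apply/set2P; rewrite -E set22.
have hx : x = a \/ x = b by apply/set2P; rewrite E set21.
have hy : y = a \/ y = b by apply/set2P; rewrite E set22.
by case: ha hb hx hy => [] ? [] ? [] ? [] ?; subst; tauto.
Qed.

Lemma mem_image_subgraph (f : {ffun H -> G}) x y :
  injective f -> ([set f x; f y] \in (image_subgraph f).2) = adj x y.
Proof.
move=> inj; apply/imset2P/idP => [[x' y' _]|xy]; last by exists x y.
rewrite unfold_in => xy /set2_inj [[/inj -> /inj ->]|[/inj -> /inj ->]] //.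
by rewrite adj_sym.
Qed.

Lemma iso_ontoE K (f : {ffun H -> G}) :
  is_subgraph K && is_iso_onto K f = (f \in homomorphic_injections) && (image_subgraph f == K).
Proof.
apply/idP/idP.
  case: K => K1 K2 /andP [/andP /= [/subsetP K2e /forall_inP K2K] /and3P [/injectiveP inj /eqP /= E1 /forallP E2]].
  have E2' x y : ([set f x; f y] \in K2) = adj x y.
    by have /forallP /(_ y) /eqP -> := E2 x.
  have edgeE a b : [set a; b] \in edges G -> adj a b.
    case/imset2P => x y _; rewrite unfold_in => xy /set2_inj [[-> ->]|[-> ->]] //.
    by rewrite adj_sym.
  apply/andP; split.
    rewrite inE; apply/andP; split; first exact/injectiveP.
    by apply/forallP => x; apply/forallP => y; apply/implyP; rewrite -E2' => /K2e /edgeE.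
  apply/eqP; rewrite /image_subgraph E1; congr (_, _); apply/setP => e; apply/imset2P/idP.
    by case=> x y _ xy ->; rewrite E2'.
  move=> eK; have /imset2P [a b _ _ eE] := K2e e eK.
  have := K2K e eK; rewrite eE subUset !sub1set -E1 => /andP [/imsetP [x _ ax] /imsetP [y _ byy]].
  have xy : adj x y by rewrite -E2' -ax -byy -eE.
  by exists x y; rewrite ?ax ?byy.
rewrite inE => /andP [/andP [/injectiveP inj /forallP hom] /eqP <-].
have homE x y : adj x y -> adj (f x) (f y) by have /forallP /(_ y) /implyP := hom x.
apply/andP; split; last first.
  apply/and3P; split=> //; first exact/injectiveP.
  by apply/forallP => x; apply/forallP => y; rewrite mem_image_subgraph.
apply/andP; split.
  apply/subsetP => e /imset2P [x y _]; rewrite unfold_in => xy ->.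
  by apply/imset2P; have fxy := homE x y xy; exists (f x) (f y).
apply/forall_inP => e /imset2P [x y _ _ ->].
by rewrite subUset !sub1set !imset_f.
Qed.

(** Composing [f0] with the automorphisms of [H] yields each isomorphism onto [K] exactly once. *)
Lemma card_iso_onto K (f0 : {ffun H -> G}) : is_iso_onto K f0 ->
  #|[set f : {ffun H -> G} | is_iso_onto K f]| = #|automorphisms|.
Proof.
move=> /and3P [/injectiveP inj0 /eqP im0 /forallP adj0].
have adj0' x y : adj x y = ([set f0 x; f0 y] \in K.2) by have /forallP /(_ y) /eqP := adj0 x.
pose comp (g : {ffun H -> H}) : {ffun H -> G} := [ffun x => f0 (g x)].
have comp_inj : injective comp.
  move=> g g' E; apply/ffunP => x; apply: inj0.
  by have := congr1 (fun h : {ffun H -> G} => h x) E; rewrite !ffunE.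
rewrite -(card_imset _ comp_inj); apply: eq_card => f; rewrite inE; apply/idP/imsetP.
  move=> /and3P [/injectiveP inj /eqP im /forallP adjf].
  have adjf' x y : adj x y = ([set f x; f y] \in K.2) by have /forallP /(_ y) /eqP := adjf x.
  have pre x : exists z, f0 z == f x.
    have : f x \in K.1 by rewrite -im imset_f.
    by rewrite -im0 => /imsetP [z _ ->]; exists z.
  pose g : {ffun H -> H} := [ffun x => xchoose (pre x)].
  have gE x : f0 (g x) = f x by rewrite ffunE; apply/eqP/(xchooseP (pre x)).
  exists g; last by apply/ffunP => x; rewrite ffunE gE.
  rewrite inE; apply/andP; split.
    by apply/injectiveP => x y E; apply: inj; rewrite -!gE E.
  by apply/forallP => x; apply/forallP => y; rewrite adjf' -!gE -adj0'.
case=> g; rewrite inE => /andP [/injectiveP injg /forallP adjg] ->.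
apply/and3P; split.
- by apply/injectiveP => x y; rewrite !ffunE => /inj0 /injg.
- rewrite -im0; apply/eqP/setP => v; apply/imsetP/imsetP => [[x _ ->]|[x _ ->]].
    by exists (g x); rewrite ?ffunE.
  by exists (invF injg x); rewrite // ffunE f_invF.
- apply/forallP => x; apply/forallP => y; rewrite !ffunE -adj0'.
  by have /forallP := adjg x; apply.
Qed.

(** Injections are grouped by their image subgraph: the images are the copies, and [card_iso_onto]
    gives the size of each fibre. *)
Lemma copies_automorphisms : copies H G * #|automorphisms| = #|homomorphic_injections|.
Proof.
rewrite -[RHS]sum1_card (partition_big image_subgraph
  (fun K => is_subgraph K && [exists f : {ffun H -> G}, is_iso_onto K f])) /=; last first.
  move=> f fH; have : is_subgraph (image_subgraph f) && is_iso_onto (image_subgraph f) f.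
    by rewrite iso_ontoE fH eqxx.
  by case/andP=> -> fi; apply/existsP; exists f.
rewrite /copies -sum_nat_const; apply: eq_big => [K|K]; first by rewrite inE.
rewrite inE => /andP [Ks /existsP [f0 f0i]].
rewrite sum1_card -(card_iso_onto f0i); apply: eq_card => f.
by rewrite inE unfold_in -iso_ontoE Ks.
Qed.

Lemma automorphisms_gt0 : 0 < #|automorphisms|.
Proof.
apply/card_gt0P; exists [ffun x => x]; rewrite inE; apply/andP; split.
  by apply/injectiveP => x y; rewrite !ffunE.
by apply/forallP => x; apply/forallP => y; rewrite !ffunE.
Qed.

End Copies.

(** * Return to the graphs and invariants of the statement *)

Lemma homomorphic_injectionsE s (r : 'I_s -> nat) (G : sgraph) :
  homomorphic_injections (complete_multipartite r) G =
  embeddings (fun x : {i : 'I_s & 'I_(r i)} => tag x) (@adj G) setT.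
Proof.
apply/setP => f; rewrite !inE; congr (_ && _).
by have -> : [forall x, f x \in [set: G]] by apply/forallP => x; rewrite inE.
Qed.

Lemma extremal_count_leq_embeddings (T I : finType) (p : T -> I) n c k :
  2 * k <= c -> c < n ->
  extremal_count p n (c + 1) k <= #|embeddings p (@adj (extremal_graph n c k)) setT|.
Proof.
move=> kc cn; set G := extremal_graph n c k.
pose K : {set G} := [set inl x | x : 'I_k].
pose J : {set G} := [set inr (inr x) | x : 'I_(n - c - 1 + k)].
have cG : #|G| = n by rewrite !card_sum !card_ord; lia.
have cK : #|K| = k by rewrite card_imset ?card_ord //; apply: inl_inj.
have cJ : #|J| = n - c - 1 + k.
  by rewrite card_imset ?card_ord // => x y [].
have cJ' : #|~: J| = c + 1 - k by have := cardsC J; rewrite cJ cG; lia.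
have KJ : [disjoint K & J].
  apply/pred0P => x /=; apply/negP => /andP [/imsetP [y _ ->] /imsetP [z _]] //.
have := @extremal_count_leq _ _ p G (@adj G) K J KJ.
rewrite cG cJ' cK subnKC; last by lia.
apply=> x y xy xyK; suff axy : adj x y by rewrite axy adj_sym.
have Jr z : inr (inr z) \in J by apply: imset_f.
have Kr z : (inr z : G) \in K = false by apply/negP => /imsetP [].
case: x y xy xyK => [x|[x|x]] [y|[y|y]] //= xy; rewrite ?Kr ?Jr ?andbF //.
Qed.

Lemma is_cycle_leq_circumference (G : sgraph) (p : seq G) : is_cycle p -> size p <= circumference G.
Proof.
move=> cp; have pG : size p < #|G|.+1.
  by rewrite ltnS; case/and3P: cp => _ _ /card_uniqP <-; exact: max_card.
have := @leq_bigmax_cond _ (fun l : 'I_#|G|.+1 => [exists q : l.-tuple G, is_cycle q])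
  (fun l => l : nat) (Ordinal pG); apply.
by apply/existsP; exists (in_tuple p).
Qed.

(** A value other than the default 0 is attained by a cycle, and a cycle on [#|G|] vertices would be
    hamiltonian. *)
Lemma circumference_lt (G : sgraph) : 2 < circumference G -> ~ hamiltonian G -> circumference G < #|G|.
Proof.
move=> c2 nh; rewrite ltnNge; apply/negP => Gc; apply: nh.
have [|l] := @eq_bigmax_cond _ [pred l : 'I_#|G|.+1 | [exists q : l.-tuple G, is_cycle q]]
  (fun l => l : nat).
  rewrite lt0n; apply/negP => /eqP c0; move: c2.
  rewrite /circumference big_pred0 // => l.
  exact: (card0_eq c0 l).
rewrite inE => /existsP [p cp] E; exists p => // x.
have up : uniq p by case/and3P: cp.
have : #|p| == #|G|.
  rewrite eqn_leq max_card (card_uniqP up) size_tuple /=.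
  by apply: leq_trans Gc _; rewrite /circumference E.
move/eqP/subset_cardP => h.
have pE : p =i G by apply/h/subset_predT.
by rewrite pE.
Qed.

Lemma min_degree_leq (G : sgraph) (x : G) : min_degree G <= degree x.
Proof.
rewrite /min_degree; have := mem_index_enum x.
elim: (index_enum _) => // y l IHl; rewrite inE big_cons => /orP [/eqP <-|/IHl].
  exact: geq_minl.
exact: leq_trans (geq_minr _ _).
Qed.

Theorem theorem1 (s : nat) (r : 'I_s -> nat) (G : sgraph) (n c k : nat)
  (s_gt0 : 0 < s)
  (r_gt0 : forall i : 'I_s, 0 < r i)
  (G_2connected : k_connected G 2)
  (G_nonhamiltonian : ~ hamiltonian G)
  (G_order : #|G| = n)
  (G_circumference : circumference G = c)
  (G_min_degree : k <= min_degree G) :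
  copies (complete_multipartite r) G
    <= maxn (extremal_copies r n c k) (extremal_copies r n c (c %/ 2)).
Proof.
pose p (x : {i : 'I_s & 'I_(r i)}) := tag x.
pose e := @adj G.
have e_sym : symmetric e := @adj_sym G.
have e_irr : irreflexive e := @adj_irr G.
have [G3 G2] := G_2connected.
have C2 : biconnected e.
  move=> v x y xv yv; have := G2 [set v]; rewrite cards1 => /(_ isT x y).
  rewrite !inE => /(_ xv yv); apply: connect_sub => a b; rewrite /adj_del /= !inE => h.
  exact: connect1.
have hc : no_cycle_above e c.
  move=> q q2 uq; rewrite -G_circumference; apply: is_cycle_leq_circumference.
  by rewrite /is_cycle q2.
have c3 : 2 < c.
  by have [q uq q2] := biconnected_cycle e_sym e_irr C2 G3; apply: leq_trans (hc q q2 uq).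
have cn : c < n.
  by rewrite -G_order -G_circumference; apply: circumference_lt; rewrite ?G_circumference.
have dk (x : G) : k <= degree x.
  exact: leq_trans G_min_degree (min_degree_leq x).
have [e' [e'_sym e'_irr ee' hc' sat']] := saturate e_sym e_irr hc.
have C2' : biconnected e'.
  move=> v x y xv yv; apply: connect_sub (C2 v x y xv yv) => a b /= /and3P [av bv ab].
  by apply: connect1; apply/and3P; split=> //; apply: ee'.
have dk' x : k <= degree_in e' setT x.
  apply: leq_trans (dk x) _; apply: subset_leq_card; apply/subsetP => y.
  by rewrite !inE; apply: ee'.
have c3n : 2 < c < #|G| by rewrite c3 G_order.
have [j [hj cj]] := core_size e'_sym e'_irr C2' sat' hc' c3n dk'.
have jc : 2 * j <= c by lia.
have bound : #|embeddings p e setT| <= extremal_count p n (c + 1) j.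
  apply: leq_trans (_ : #|embeddings p e' setT| <= _).
    apply: subset_leq_card; apply/subsetP => f; rewrite !inE => /and3P [-> -> /forallP fe] /=.
    apply/forallP => x; apply/forallP => y; apply/implyP => pxy.
    by have /forallP /(_ y) /implyP /(_ pxy) /ee' := fe x.
  rewrite -G_order; apply: embeddings_leq_extremal => //; [lia|].
  by rewrite G_order; lia.
have a_gt0 := automorphisms_gt0 (complete_multipartite r).
rewrite -(leq_pmul2r a_gt0) /extremal_copies maxnMl !copies_automorphisms !homomorphic_injectionsE.
apply: leq_trans bound _.
have lower i : 2 * i <= c ->
  extremal_count p n (c + 1) i <= #|embeddings p (@adj (extremal_graph n c i)) setT|.
  by move=> ic; apply: extremal_count_leq_embeddings.
(* For [j = c %/ 2] the second term of the maximum is already the bound; in the other case [j] lies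
   between [k] and [c %/ 2], and convexity moves it to an end of this interval. *)
case: hj => [hj|->]; last first.
  by rewrite leq_max lower ?orbT //; lia.
apply: leq_trans (convex_leq_maxn (k := k) (t := c %/ 2) _ hj) _.
  by move=> i it; apply: extremal_count_convex; lia.
rewrite geq_max !leq_max !lower ?orbT //; lia.
Qed.
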